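(* Let $\alpha>0$, $\omega\ge1$, and let $F$ be a continuous distribution function supported on $[0,\infty)$ with $\overline F\in SR_{-\alpha,\omega}$. Let $m$ be a nonnegative integer with $m<\alpha$ and $m<\omega$, and let $\gamma$ be a real number with $0<\gamma<\min(1,\omega-m)$. Let $X_1,X_2,\dots$ be independent with distribution $F$, $S_0=0$, $S_n=X_1+\dots+X_n$, and let $N$ be a random variable with values in $\{0,1,2,\dots\}$, independent of $(X_i)$. Let $K$ be the distribution function of $S_N$. If $E N^s<\infty$ for some $$s>\frac{\alpha+m}{\gamma}\Bigl(\frac{\alpha+\omega}{\alpha}\vee2\Bigr)+m,$$ then, as $t\to\infty$, $$\overline K(t)=\sum_{j=0}^m\frac{(-1)^j}{j!}E\bigl[N\,\mu_{F^{\star(N-1)},j}\bigr]\,\overline F^{(j)}(t)+o\bigl(t^{-m}\overline F(t)\bigr),$$ i.e. $\overline K=E\,N\mathsf L_{F^{\star(N-1)},m}\overline F+o(\mathrm{Id}^{-m}\overline F)$, where terms with $N=0$ are zero.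
   Context: $\overline H=1-H$ for a distribution function $H$; $\mu_{H,j}=\int x^j\,dH(x)$; $F^{\star n}$ is the $n$-fold convolution power, with $F^{\star0}$ the point mass at $0$; $\mathsf L_{H,m}=\sum_{j=0}^m\frac{(-1)^j}{j!}\mu_{H,j}\mathrm D^j$ with $\mathrm D^jh=h^{(j)}$. Smooth variation: with $\Delta^r_{t,x}g=\mathrm{sign}(x)\frac{g(t(1-x))-g(t)}{|x|^rg(t)}$, for a positive integer $q$, $SR_{-\alpha,q}$ is the set of functions $h$ that are ultimately $q$ times continuously differentiable with $|h^{(q)}|$ regularly varying of index $-\alpha-q$; for real $s\ge1$ with integer part $q$ and $r=s-q$, $h\in SR_{-\alpha,s}$ means $h\in SR_{-\alpha,q}$ and $\lim_{\delta\to0}\limsup_{t\to\infty}\sup_{0<|x|\le\delta}|\Delta^r_{t,x}h^{(q)}|=0$. *)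

(* Defs.v *)
From HB Require Import structures.
From mathcomp Require Import all_boot all_order all_algebra.
From mathcomp Require Import all_classical all_reals all_analysis.
Set Implicit Arguments. Unset Strict Implicit. Unset Printing Implicit Defensive.
Import Order.TTheory GRing.Theory Num.Theory.
Import numFieldNormedType.Exports.
Local Open Scope classical_set_scope.
Local Open Scope ring_scope.

Section Defs.
Variable R : realType.

Definition regvar (g : R -> R) (rho : R) : Prop :=
  (\forall t \near +oo, 0 < g t) /\
  forall l : R, 0 < l -> (fun t => g (l * t) / g t) @ +oo --> l `^ rho.

Definition ult_Cq (q : nat) (h : R -> R) : Prop :=
  exists t0 : R,
    (forall k : nat, (k < q)%N -> forall t, t0 < t -> derivable (derive1n k h) t 1)
    /\ (forall t, t0 < t -> {for t, continuous (derive1n q h)}).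

Definition SRint (alpha : R) (q : nat) (h : R -> R) : Prop :=
  (0 < q)%N /\ ult_Cq q h /\
  regvar (fun t => `|derive1n q h t|) (- alpha - q%:R).

Definition Delta (r t x : R) (g : R -> R) : R :=
  Num.sg x * (g (t * (1 - x)) - g t) / (`|x| `^ r * g t).

(* SR_{-alpha,s} for real s >= 1, with q = floor s, r = s - q.
   lim_{delta->0} limsup_{t->oo} sup_{0<|x|<=delta} |Delta| = 0 is written out
   (the inner quantity is monotone in delta). For r = 0 (s integer) only the
   integer-order definition is required, as in the paper. *)
Definition SR (alpha s : R) (h : R -> R) : Prop :=
  let q := `|Num.floor s|%N in
  let r := s - q%:R in
  1 <= s /\ SRint alpha q h /\
  (0 < r -> forall eps : R, 0 < eps -> exists delta : R, 0 < delta /\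
     exists T : R, forall t x : R, T < t -> 0 < `|x| -> `|x| <= delta ->
       `|Delta r t x (derive1n q h)| <= eps).

(* Integral of g against F^{*n}, where F is the distribution function of mu:
   conv_int mu n g = E g(X_1 + ... + X_n) for X_i iid ~ mu;
   F^{*0} is the point mass at 0. *)
Fixpoint conv_int (mu : probability R R) (n : nat) (g : R -> R) : \bar R :=
  match n with
  | 0%N => (g 0)%:E
  | n'.+1 => (\int[mu]_x conv_int mu n' (fun y => g (x + y)%R))%E
  end.

Definition distr_fun (mu : probability R R) (t : R) : R :=
  fine (mu `]-oo, t]%classic).

Definition convpow (mu : probability R R) (n : nat) (t : R) : R :=
  fine (conv_int mu n (fun y => \1_(`]-oo, t]%classic) y)).

Definition moment (mu : probability R R) (n j : nat) : \bar R :=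
  conv_int mu n (fun y => y ^+ j).

(* distribution function of S_N, N independent of (X_i) with P(N = n) = p n *)
Definition compound_df (mu : probability R R) (p : nat -> R) (t : R) : R :=
  limn (series (fun n => p n * convpow mu n t)).

Definition cmp_coef (mu : probability R R) (p : nat -> R) (j : nat) : \bar R :=
  (\sum_(1 <= n <oo) ((p n * n%:R)%:E * moment mu n.-1 j))%E.

Definition littleo_pinfty (f g : R -> R) : Prop :=
  forall eps : R, 0 < eps -> \forall t \near +oo, `|f t| <= eps * `|g t|.

End Defs.

(* Main.v *)
Require Import Defs.
From HB Require Import structures.
From mathcomp Require Import all_boot all_order all_algebra.
From mathcomp Require Import all_classical all_reals all_analysis.
From mathcomp Require Import measurable_realfun.
From mathcomp Require Import ring lra.
Set Implicit Arguments. Unset Strict Implicit. Unset Printing Implicit Defensive.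
Import Order.TTheory GRing.Theory Num.Theory.
Import numFieldNormedType.Exports.
Local Open Scope classical_set_scope.
Local Open Scope ring_scope.

(** Write [h] for the tail of [F] and [S_n] for the random walk.  Two facts drive
    the proof.

    Smooth variation: integrating the regular variation of the top derivative
    down (l'Hopital at infinity) shows that [h] is regularly varying with index
    [-alpha] and that each [h^(j)], [j <= m], barely changes on [[t (1 - delta), t]].
    Hence the Taylor remainder of order [m] of [h (t - y)] is at most
    [C y^m t^-m h(t)] for [0 <= y <= delta t], and is [o(t^-m h(t))] for fixed [y].

    One big jump: with [u = delta t / n], either at most one summand exceeds [u],
    or two of them do, which has probability at most [n^2 h(u)^2].  This gives
    [P(S_n > t) = n E[h(t - S_{n-1}); S_{n-1} <= delta t] + O(n^2 h(u)^2)], and the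
    error is also at most [1 + n h(u)], so at most [2 (n h(u))^k] for every [k] in
    [[1, 2]].  Choosing [k] slightly above [(m + alpha) / alpha], Potter's bounds
    turn this into [O(n^s t^-eta t^-m h(t))] for some [eta > 0]; this is the only
    place where the size of [s] matters.

    Summing against [P(N = n)], dominated convergence applies with majorant
    [C n^s] and yields the expansion. *)

(** Smooth variation gives the size of the derivative of order [q], the integer part of [omega],
    only in absolute value: its sign comes from continuity and is passed down by integration. The
    delicate order is [m = q], where no monotonicity is known; but then [omega > q], and the
    Holder-type condition on [Delta] takes its place.

    In the sum over [n] the obstacle is uniformity: when [n] is comparable with [t], the threshold
    [u] is no longer large and two jumps above it are likely. With [a = n h(u)], a power [a^k] costs
    [n^(k (1 + alpha))] and gains [t^(- k alpha)], up to small losses. The gain has to beat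
    [t^(- m - alpha)], which forces [k > (m + alpha) / alpha]; since two jumps yield no more than
    the square, [k <= 2] is required as well, and [m < alpha] leaves room for both.

    The decomposition by jumps is carried out with positive operators on functions instead of
    events, so that counting the position of the large jump becomes commutation of operators. *)

Section Calculus.

(** * Monotonicity and ratios of functions near infinity *)

Variable R : realType.
Implicit Types (f g df : R -> R) (t x y l T rho eps sg : R).

Lemma near_pinftyP (P : R -> Prop) :
  (\forall t \near +oo, P t) <-> exists T : R, forall t, T < t -> P t.
Proof.
split=> [[T [_ PT]]|[T PT]]; first by exists T.
by exists T; split; [exact: num_real|exact: PT].
Qed.

Lemma cvg_pinfty_distP f l : f @ +oo --> l <->
  forall eps, 0 < eps -> exists T : R, forall t, T < t -> `|f t - l| <= eps.
Proof.
split=> [/cvgrPdist_le fl eps e0|fl].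
  have /near_pinftyP[T fT] := fl _ e0.
  by exists T => t Tt; rewrite distrC; exact: fT.
apply/cvgrPdist_le => eps e0; apply/near_pinftyP.
have [T fT] := fl _ e0; exists T => t Tt; rewrite distrC; exact: fT.
Qed.

Lemma mvt_pinfty f df T x y :
  (forall t, T < t -> is_derive t 1 f (df t)) -> T < x -> x <= y ->
  exists2 c : R, x <= c <= y & f y - f x = df c * (y - x).
Proof.
move=> fd Tx xy.
have [c cxy e] : exists2 c : R, c \in `[x, y] & f y - f x = df c * (y - x).
  apply: MVT_segment => // [z|].
    by rewrite in_itv/= => /andP[xz _]; apply: fd; exact: lt_trans xz.
  apply: derivable_within_continuous => z; rewrite in_itv/= => /andP[xz _].
  by have [] : is_derive z 1 f (df z) by apply: fd; exact: lt_le_trans xz.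
by exists c => //; move: cxy; rewrite in_itv.
Qed.

Lemma derivable_is_derive1 f t : derivable f t 1 -> is_derive t 1 f (derive1 f t).
Proof. by move=> fd; rewrite derive1E; exact/derivableP. Qed.

Lemma is_derive_cstM f (d : R) t l :
  is_derive t 1 f d -> is_derive t 1 (fun x => l * f x) (l * d).
Proof. by move=> fd; have := @is_deriveZ _ _ _ f l t 1 d fd. Qed.

Lemma nonincr_of_deriv f df T :
  (forall t, T < t -> is_derive t 1 f (df t)) ->
  (forall t, T < t -> df t <= 0) ->
  forall x y, T < x -> x <= y -> f y <= f x.
Proof.
move=> fd df0 x y Tx xy; have [c /andP[xc _] e] := mvt_pinfty fd Tx xy.
rewrite -subr_le0 e mulr_le0_ge0 ?subr_ge0//; apply: df0; exact: lt_le_trans xc.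
Qed.

Lemma decr_of_deriv f df T :
  (forall t, T < t -> is_derive t 1 f (df t)) ->
  (forall t, T < t -> df t < 0) ->
  forall x y, T < x -> x < y -> f y < f x.
Proof.
move=> fd df0 x y Tx xy; have [c /andP[xc _] e] := mvt_pinfty fd Tx (ltW xy).
by rewrite -subr_lt0 e pmulr_llt0 ?subr_gt0//; apply: df0; exact: lt_le_trans xc.
Qed.

Lemma nonincr_cvg0_ge0 f T :
  (forall x y, T < x -> x <= y -> f y <= f x) -> f @ +oo --> (0 : R) ->
  forall x, T < x -> 0 <= f x.
Proof.
move=> fn /cvg_pinfty_distP f0 x Tx; rewrite leNgt; apply/negP => fx0.
have [|T' fT'] := f0 (- f x / 2); first by rewrite divr_gt0// oppr_gt0.
pose y := Num.max x (T' + 1).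
have Ty : T' < y by rewrite /y lt_max ltrDl ltr01 orbT.
have := fT' _ Ty; rewrite subr0 ler_norml => /andP[h _].
have := fn x y Tx; rewrite /y le_max lexx => /(_ isT); rewrite -/y.
lra.
Qed.

(* l'Hopital at infinity: [s |-> f (l s) - k f s] is monotone for k close to the
   limit of the ratio of the derivatives, and it vanishes at infinity. *)
Lemma cvg_ratio_of_deriv f df T rho :
  (forall t, T < t -> is_derive t 1 f (df t)) ->
  (forall t, T < t -> df t < 0) -> f @ +oo --> (0 : R) ->
  (forall l, 0 < l -> (fun t => df (l * t) / df t) @ +oo --> l `^ (rho - 1)) ->
  forall l, 0 < l -> (fun t => f (l * t) / f t) @ +oo --> l `^ rho.
Proof.
move=> fd df0 f0 dfl l l0.
have f_gt0 t : T < t -> 0 < f t.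
  move=> Tt; have Tt1 : T < t + 1 by lra.
  apply: (@le_lt_trans _ _ (f (t + 1))).
    by apply: (nonincr_cvg0_ge0 (T := T)) => // x y; apply: nonincr_of_deriv fd _ x y => ? /df0/ltW.
  by apply: decr_of_deriv fd df0 _ _ Tt _; lra.
have fl0 : (fun t => f (l * t)) @ +oo --> (0 : R).
  apply/cvg_pinfty_distP => eps e0; have /cvg_pinfty_distP/(_ _ e0)[T' fT'] := f0.
  exists (T' / l) => t; rewrite ltr_pdivrMr// => Tt; apply: fT'; lra.
have lrho : l * l `^ (rho - 1) = l `^ rho.
  by rewrite -[X in X * _](powRr1 (ltW l0)) -powRD ?(gt_eqF l0) ?implybT// addrC subrK.
apply/cvg_pinfty_distP => eps e0.
(* The derivative of [f (l s)] is [l df (l s)], so an error [eps / l] on the ratio of derivatives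
   becomes [eps]. *)
have /cvg_pinfty_distP/(_ (eps / l) (divr_gt0 e0 l0))[T1 dT1] := dfl _ l0.
pose S := Num.max T1 (Num.max T (T / l)).
have ST s : S < s -> [/\ T1 < s, T < s & T < l * s].
  by rewrite !gt_max ltr_pdivrMr// => /and3P[-> ->]; rewrite mulrC.
have dS s : S < s -> `|l * df (l * s) - l `^ rho * df s| <= - eps * df s.
  move=> /ST[/dT1 + Ts Tls]; have ds := df0 _ Ts.
  rewrite -(ler_pM2r (_ : 0 < l * - df s)); last by rewrite mulr_gt0// oppr_gt0.
  rewrite -{1}(gtr0_norm (_ : 0 < l * - df s)); last by rewrite mulr_gt0// oppr_gt0.
  rewrite -normrM -lrho => h.
  have -> : - eps * df s = eps / l * (l * - df s) by field; rewrite gt_eqF.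
  apply: le_trans h; rewrite -normrN le_eqVlt; apply/orP; left; apply/eqP; congr `|_|.
  by field; rewrite lt_eqF.
have dphi k s : S < s -> is_derive s 1 (fun s => k * (f (l * s) - l `^ rho * f s) - eps * f s)
   (k * (l * df (l * s) - l `^ rho * df s) - eps * df s).
  move=> /ST[_ Ts Tls].
  have d1 : is_derive s 1 (fun s => f (l * s)) (l * df (l * s)).
    have dl : is_derive s 1 (fun s : R => l * s) (l * 1) by exact: is_derive_cstM.
    have := @is_derive1_comp _ f (fun s => l * s) s _ _ (fd _ Tls) dl.
    by rewrite mulr1 mulrC.
  have d2 := is_derive_cstM (l `^ rho) (fd _ Ts).
  have d3 := is_derive_cstM k (@is_deriveB _ _ _ _ _ _ _ _ _ d1 d2).
  exact: (@is_deriveB _ _ _ _ _ _ _ _ _ d3 (is_derive_cstM eps (fd _ Ts))).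
have phi0 k : (fun s => k * (f (l * s) - l `^ rho * f s) - eps * f s) @ +oo --> (0 : R).
  rewrite -[X in _ --> X](_ : k * (0 - l `^ rho * 0) - eps * 0 = 0); last by ring.
  by apply: cvgB; [apply: cvgMl_tmp; apply: cvgB => //; exact: cvgMl_tmp|exact: cvgMl_tmp].
(* Here [k] is a sign, and its two values give the two sides of the absolute value. The function in
   [phi0] is nondecreasing by [dS] and tends to 0, hence is nonpositive. *)
have key k t : k = 1 \/ k = -1 -> S < t -> k * (f (l * t) - l `^ rho * f t) <= eps * f t.
  move=> k1 St.
  have := @nonincr_cvg0_ge0 (fun s => - (k * (f (l * s) - l `^ rho * f s) - eps * f s)) S.
  move=> /(_ _ _ _ St); rewrite oppr_ge0 subr_le0; apply.
    move=> x y Sx xy; rewrite lerN2 -subr_ge0.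
    have [c /andP[xc _] ->] := mvt_pinfty (dphi k) Sx xy.
    rewrite mulr_ge0 ?subr_ge0//.
    have /dS : S < c by exact: lt_le_trans xc.
    by rewrite ler_norml => /andP[]; case: k1 => ->; lra.
  by rewrite -oppr0; exact: cvgN.
exists S => t St; have [_ Tt _] := ST _ St; have ft := f_gt0 _ Tt.
rewrite -(ler_pM2r ft) -[X in _ * X <= _](gtr0_norm ft) -normrM mulrBl divfK ?gt_eqF//.
have := key 1 t (or_introl erefl) St; have := key (-1) t (or_intror erefl) St.
by rewrite ler_norml; lra.
Qed.
End Calculus.

(** * Consequences of smooth variation for the derivatives of the tail *)

Section SmoothVariation.
Variable R : realType.
Implicit Types (f g df : R -> R) (t x y l T rho eps sg alpha omega : R).

(** The equation on [sg] encodes a sign, 1 or -1, which is constant near infinity but not known in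
    advance. *)
Definition ult_sign f := exists2 sg : R, sg * sg = 1 &
  exists T : R, forall t, T < t -> 0 < sg * f t.

Definition cvg_ratio f rho :=
  forall l, 0 < l -> (fun t => f (l * t) / f t) @ +oo --> l `^ rho.

(** One-sided, because the value at [t] is only compared with values at [t - y], [y >= 0]. *)
Definition slow_at f := forall eps, 0 < eps -> exists2 delta : R, 0 < delta &
  exists T : R, forall t s, T < t -> t * (1 - delta) <= s -> s <= t ->
    `|f s - f t| <= eps * `|f t|.

(** [f] is eventually strictly monotone: once it reaches 0 it stays beyond it, and if it never does
    it keeps the opposite sign. *)
Lemma ult_sign_primitive f df T :
  (forall t, T < t -> is_derive t 1 f (df t)) -> ult_sign df -> ult_sign f.
Proof.
move=> fd [sg sg1 [T' dfT]].
pose S := Num.max T T'.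
have dfS t : S < t -> is_derive t 1 (fun x => - sg * f x) (- sg * df t).
  by rewrite gt_max => /andP[Tt _]; exact: is_derive_cstM (fd _ Tt).
have df0 t : S < t -> - sg * df t < 0.
  by rewrite gt_max => /andP[_ Tt]; rewrite mulNr oppr_lt0; exact: dfT.
have dec := decr_of_deriv dfS df0.
have [[x Sx fx]|fS] := pselect (exists2 x, S < x & 0 <= sg * f x).
  exists sg => //; exists x => t xt; have := dec x t Sx xt.
  by move: fx; lra.
exists (- sg); first by rewrite mulrNN.
exists S => t St; rewrite mulNr oppr_gt0 ltNge; apply/negP => ft.
by apply: fS; exists t.
Qed.

(** A monotone function with limit 0 moves towards 0, so its sign is opposite to that of its
    derivative. *)
Lemma ult_sign_nonincr_abs f df T :
  (forall t, T < t -> is_derive t 1 f (df t)) -> ult_sign df -> f @ +oo --> (0 : R) ->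
  exists2 sg : R, sg * sg = 1 & exists T : R, [/\ forall t, T < t -> 0 < sg * f t,
    forall x y, T < x -> x <= y -> sg * f y <= sg * f x & forall t, T < t -> sg * df t < 0].
Proof.
move=> fd [sg sg1 [T' dfT]] f0; exists (- sg); first by rewrite mulrNN.
pose S := Num.max T T'; exists S.
have dfS t : S < t -> is_derive t 1 (fun x => - sg * f x) (- sg * df t).
  by rewrite gt_max => /andP[Tt _]; exact: is_derive_cstM (fd _ Tt).
have df0 t : S < t -> - sg * df t < 0.
  by rewrite gt_max => /andP[_ Tt]; rewrite mulNr oppr_lt0; exact: dfT.
have dec := decr_of_deriv dfS df0.
have ninc := nonincr_of_deriv dfS (fun t St => ltW (df0 t St)).
split => //.
move=> t St; apply: (@le_lt_trans _ _ (- sg * f (t + 1))).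
  have f0' : (fun x => - sg * f x) @ +oo --> (0 : R).
    by rewrite -(mulr0 (- sg)); exact: cvgMl_tmp.
  apply: (nonincr_cvg0_ge0 ninc f0'); lra.
by apply: dec => //; lra.
Qed.

(** The mean value theorem finds a point with small [df] in every unit interval far out. As [df] is
    monotone, two such points on either side of [t] trap [df t]. *)
Lemma cvg0_deriv f df ddf T :
  (forall t, T < t -> is_derive t 1 f (df t)) ->
  (forall t, T < t -> is_derive t 1 df (ddf t)) -> ult_sign ddf ->
  f @ +oo --> (0 : R) -> df @ +oo --> (0 : R).
Proof.
move=> fd dfd [sg sg1 [T' ddfT]] /cvg_pinfty_distP f0; apply/cvg_pinfty_distP => eps e0.
have [T1 fT1] := f0 _ (divr_gt0 e0 (ltr0Sn _ 1)).
pose S := Num.max T1 (Num.max T T').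
have inc x y : S < x -> x <= y -> sg * df x <= sg * df y.
  rewrite !gt_max => /and3P[_ Tx T'x] xy.
  have [|c /andP[xc _] e] := mvt_pinfty (f := fun x => sg * df x) (df := fun x => sg * ddf x) _ Tx xy.
    by move=> t /dfd; exact: is_derive_cstM.
  by rewrite -subr_ge0 e mulr_ge0 ?subr_ge0//; apply/ltW/ddfT; exact: lt_le_trans xc.
have near x : S < x -> exists2 c : R, x <= c <= x + 1 & `|df c| <= eps.
  rewrite !gt_max => /and3P[T1x Tx T'x].
  have [|c xc e] := mvt_pinfty fd Tx (_ : x <= x + 1); first by lra.
  exists c => //.
  have := fT1 x T1x; have := fT1 (x + 1) (lt_trans T1x (_ : x < x + 1)).
  rewrite ltrDl ltr01 => /(_ isT); rewrite !subr0 => h1 h2.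
  have -> : df c = f (x + 1) - f x by rewrite e addrC addKr mulr1.
  by rewrite (le_trans (ler_normB _ _))//; lra.
have sg1' : `|sg| = 1.
  by apply/eqP; rewrite -(@sqrp_eq1 R)// expr2 -normrM sg1 normr1.
exists (S + 1) => t St; rewrite subr0.
have [|a /andP[a1 a2] ha] := near (t - 1); first lra.
have [|b /andP[b1 b2] hb] := near t; first lra.
rewrite -[`|_|]mul1r -sg1' -normrM ler_norml.
have h1 : `|sg * df a| <= eps by rewrite normrM sg1' mul1r.
have h2 : `|sg * df b| <= eps by rewrite normrM sg1' mul1r.
have := inc a t _ _; have := inc t b _ b1.
move: h1 h2; rewrite !ler_norml => /andP[u1 u2] /andP[v1 v2] w1 w2.
by apply/andP; split; [apply: (le_trans u1); apply: w2; lra|apply: le_trans v2; apply: w1; lra].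
Qed.

Lemma cvg_ratio_primitive f df T rho :
  (forall t, T < t -> is_derive t 1 f (df t)) -> ult_sign df -> f @ +oo --> (0 : R) ->
  cvg_ratio df (rho - 1) -> cvg_ratio f rho.
Proof.
move=> fd sdf f0 dfr.
have [sg sg1 [S [_ _ dfS]]] := ult_sign_nonincr_abs fd sdf f0.
have sg0 : sg != 0 by apply/eqP => sg0; move: sg1; rewrite sg0 mul0r => /eqP; rewrite eq_sym oner_eq0.
have ratioE (h : R -> R) l : (fun t => (sg * h (l * t)) / (sg * h t)) = (fun t => h (l * t) / h t).
  by apply/funext => t; rewrite -mulf_div divff// mul1r.
move=> l l0; rewrite -ratioE.
pose S' := Num.max S T.
apply: (@cvg_ratio_of_deriv _ (fun x => sg * f x) (fun x => sg * df x) S' rho) => //.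
- by move=> t; rewrite gt_max => /andP[_ Tt]; exact: is_derive_cstM (fd _ Tt).
- by move=> t; rewrite gt_max => /andP[Tt _]; exact: dfS.
- by rewrite -(mulr0 sg); exact: cvgMl_tmp.
- by move=> k k0; rewrite ratioE; exact: dfr.
Qed.

Lemma continuous_powR_base1 rho : (fun x => x `^ rho) @ (1 : R) --> (1 : R).
Proof.
apply: (@cvg_trans _ (expR (rho * ln x) @[x --> (1 : R)])).
  apply: near_eq_cvg; near=> x; rewrite /powR gt_eqF//.
  by near: x; exact: lt_nbhsr.
have e1 : expR (rho * ln (1 : R)) = 1 by rewrite ln1 mulr0 expR0.
rewrite -[X in _ `=>` nbhs X]e1.
have : {for (1 : R), continuous (expR \o (fun x : R => rho * ln x))}.
  apply: continuous_comp; last exact: continuous_expR.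
  by apply: cvgMl_tmp; exact: continuous_ln.
by apply.
Unshelve. all: by end_near. Qed.

(** On [[t (1 - d), t]] the absolute value is largest at the left end, where its ratio to the value
    at [t] tends to [(1 - d)^rho], close to 1 for small [d]. *)
Lemma slow_at_nonincr_abs f T sg rho :
  (forall t, T < t -> 0 < sg * f t) -> sg * sg = 1 ->
  (forall x y, T < x -> x <= y -> sg * f y <= sg * f x) ->
  cvg_ratio f rho -> slow_at f.
Proof.
move=> f0 sg1 fn fr eps e0.
have [d d0 [d1 hd]] : exists2 d : R, 0 < d & d < 1 /\ `|(1 - d) `^ rho - 1| <= eps / 2.
  have /cvgrPdist_le/(_ _ (divr_gt0 e0 (ltr0Sn _ 1))) := continuous_powR_base1 rho.
  move=> [r /= r0 hr]; exists (Num.min (r / 2) (1 / 2)); first by rewrite lt_min !divr_gt0.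
  split; first by rewrite gt_min; apply/orP; right; lra.
  rewrite distrC; apply: hr => /=.
  rewrite opprB addrC subrK ger0_norm; last by rewrite le_min !divr_ge0// ltW.
  by rewrite gt_min ltr_pdivrMr ?mulr_natr ?ltr_pMn2l//; apply/orP; left; lra.
have d1' : 0 < 1 - d by rewrite subr_gt0.
have /cvg_pinfty_distP/(_ _ (divr_gt0 e0 (ltr0Sn _ 1)))[T1 hT1] := fr _ d1'.
exists d => //; exists (Num.max T1 (Num.max 0 (T / (1 - d)))) => t s.
rewrite !gt_max ltr_pdivrMr ?subr_gt0// => /and3P[T1t t0 Tt] st1 st2.
have sg1' : `|sg| = 1.
  by apply/eqP; rewrite -(@sqrp_eq1 R)// expr2 -normrM sg1 normr1.
have Tt' : T < t by nra.
have ft := f0 _ Tt'.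
rewrite -[`|f t|]mul1r -[X in X <= _]mul1r -sg1' -!normrM (gtr0_norm ft) mulrBr.
have h1 := fn _ _ Tt st1; have h2 := fn s t (lt_le_trans Tt st1) st2.
rewrite ger0_norm ?subr_ge0// lerBlDr; apply: (le_trans h1).
have := hT1 _ T1t; rewrite (mulrC (1 - d)) => h3.
have ratio : f (t * (1 - d)) / f t <= 1 + eps.
  by move: h3 hd; rewrite !ler_norml => /andP[_ ?] /andP[_ ?]; lra.
have ft0 : f t != 0 by apply/eqP => ft0; move: ft; rewrite ft0 mulr0 ltxx.
have -> : sg * f (t * (1 - d)) = (f (t * (1 - d)) / f t) * (sg * f t) by field.
by rewrite -[X in _ <= _ + X]mul1r -mulrDl ler_pM2r// (addrC eps).
Qed.


Lemma ult_sign_continuous f T : (forall t, T < t -> {for t, continuous f}) ->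
  (forall t, T < t -> 0 < `|f t|) -> ult_sign f.
Proof.
move=> fc f0; pose x := T + 1; have Tx : T < x by rewrite ltrDl.
have fx0 : f x != 0 by rewrite -normr_gt0 f0.
exists (Num.sg (f x)); first by rewrite -expr2 sqr_sg fx0.
exists x => t xt; rewrite ltNge; apply/negP => ft.
have [c cxt fc0] : exists2 c : R, c \in `[x, t] & f c = 0.
  apply: IVT; first exact: ltW.
    apply: continuous_in_subspaceT => z; rewrite inE/= in_itv/= => /andP[xz _].
    by apply: fc; exact: lt_le_trans xz.
  have [fx|fx] := ltP 0 (f x).
    move: ft; rewrite gtr0_sg// mul1r => ft.
    by rewrite ge_min le_max (ltW fx) ft orbT.
  have {}fx : f x < 0 by rewrite lt_neqAle fx0.
  move: ft; rewrite ltr0_sg// mulN1r oppr_le0 => ft.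
  by rewrite ge_min le_max (ltW fx) ft orbT.
move: cxt; rewrite in_itv/= => /andP[xc _].
by have := f0 _ (lt_le_trans Tx xc); rewrite fc0 normr0 ltxx.
Qed.

Lemma cvg_ratio_abs f rho : ult_sign f ->
  (forall l, 0 < l -> (fun t => `|f (l * t)| / `|f t|) @ +oo --> l `^ rho) ->
  cvg_ratio f rho.
Proof.
move=> [sg sg1 [T fT]] fr l l0; apply: cvg_trans (fr l l0).
apply: near_eq_cvg; apply/near_pinftyP; exists (Num.max T (T / l)) => t.
rewrite gt_max ltr_pdivrMr// => /andP[Tt Tlt].
rewrite -normf_div ger0_norm//.
have ft := fT _ Tt; have flt : 0 < sg * f (l * t) by apply: fT; rewrite mulrC.
have sg0 : sg != 0 by apply: contra_eqN sg1 => /eqP ->; rewrite mul0r eq_sym oner_eq0.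
have -> : f (l * t) / f t = (sg * f (l * t)) / (sg * f t).
  by rewrite -mulf_div divff// mul1r.
by rewrite divr_ge0// ltW.
Qed.

Lemma slow_at_Delta f (r : R) : 0 < r -> (exists T : R, forall t, T < t -> 0 < `|f t|) ->
  (forall eps, 0 < eps -> exists delta : R, 0 < delta /\
     exists T : R, forall t x : R, T < t -> 0 < `|x| -> `|x| <= delta ->
       `|Delta r t x f| <= eps) -> slow_at f.
Proof.
move=> r0 [T0 fT0] hD eps e0; have [d [d0 [T hT]]] := hD _ e0.
exists (Num.min d 1); first by rewrite lt_min d0 ltr01.
exists (Num.max T (Num.max T0 0)) => t s; rewrite !gt_max => /and3P[Tt T0t t0] st1 st2.
have [->|st] := eqVneq s t; first by rewrite subrr normr0 mulr_ge0// ltW.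
have {}st2 : s < t by rewrite lt_neqAle st st2.
pose x : R := 1 - s / t.
have x0 : 0 < x by rewrite subr_gt0 ltr_pdivrMr// mul1r.
have xd : x <= Num.min d 1.
  by rewrite lerBlDr -lerBlDl ler_pdivlMr// mulrC.
have sE : t * (1 - x) = s by rewrite /x opprB addrC subrK mulrC divfK ?gt_eqF.
have ft : 0 < `|f t| by exact: fT0.
have := hT t x Tt; rewrite (gtr0_norm x0) => /(_ x0 (le_trans xd _)).
rewrite ge_min lexx => /(_ isT); rewrite /Delta sE gtr0_sg// mul1r (gtr0_norm x0).
have xr : 0 < x `^ r by exact: powR_gt0.
rewrite normrM normfV normrM (gtr0_norm xr) ler_pdivrMr ?mulr_gt0// => h.
apply: (le_trans h); rewrite ler_pM2l// -[leRHS]mul1r ler_pM2r//.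
have x1 : x <= 1 by rewrite (le_trans xd)// ge_min lexx orbT.
have -> : (1 : R) = 1 `^ r by rewrite powR1.
by apply: ge0_ler_powR => //; rewrite ?nnegrE ltW.
Qed.

(** Signs and limiting ratios descend from order [q] by integration. The limit 0 ascends from order
    0 by [cvg0_deriv]; the descent of ratios needs it to fix the constant of integration. *)
Lemma SR_structure (h : R -> R) alpha omega (m : nat) :
  SR alpha omega h -> h @ +oo --> (0 : R) -> m%:R < omega ->
  [/\ exists T : R, forall j t, (j < m)%N -> T < t ->
        is_derive t 1 (derive1n j h) (derive1n j.+1 h t),
      forall j, (j <= m)%N -> slow_at (derive1n j h) &
      cvg_ratio h (- alpha)].
Proof.
move=> [om1 [[q0 [[T0 [hd hc]] [hpos hreg]]] hD]] h0 mom.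
move: q0 hd hc hpos hreg hD.
have qE : (`|Num.floor omega|%N)%:R = (Num.floor omega)%:~R :> R.
  by rewrite natr_absz ger0_norm// floor_ge0 (le_trans ler01).
have mq : (m <= `|Num.floor omega|)%N.
  rewrite -ltnS -(@ltr_nat R) -natr1 qE; apply: (lt_le_trans mom).
  by rewrite ltW// -(intrD _ _ 1) floorD1_gt.
set q := `|Num.floor omega|%N in qE mq * => q0 hd hc hpos hreg hD.
have der j t : (j < q)%N -> T0 < t -> is_derive t 1 (derive1n j h) (derive1n j.+1 h t).
  by move=> jq Tt; rewrite derive1nS; apply: derivable_is_derive1; exact: hd.
have /near_pinftyP[T1 hT1] := hpos.
have sq : ult_sign (derive1n q h).
  apply: (@ult_sign_continuous _ (Num.max T0 T1)) => t; rewrite gt_max => /andP[Tt T't].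
    exact: hc.
  exact: hT1.
have sgn j : (j <= q)%N -> ult_sign (derive1n j h).
  (* Induction on the distance [q - j] from the top order; past [q], truncated subtraction stays at
     order 0 and there is nothing new to prove. *)
  move=> jq; rewrite -(subKn jq); elim: (q - j)%N => [|k IH]; first by rewrite subn0.
  have [qk|kq] := leqP q k.
    by rewrite (_ : q - k.+1 = q - k)%N// subnS; move/eqP: qk => ->.
  apply: (@ult_sign_primitive _ (derive1n (q - k) h) T0) => // t Tt.
  have := @der (q - k.+1)%N t; rewrite -subSn// subSS; apply => //.
  by rewrite leq_subr.
have lim j : (j < q)%N -> derive1n j h @ +oo --> (0 : R).
  elim: j => [//|j IH] jq; apply: (@cvg0_deriv (derive1n j h) _ (derive1n j.+2 h) T0).
  - by move=> t; apply: der; exact: ltnW.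
  - by move=> t; exact: der.
  - exact: sgn.
  - by apply: IH; exact: ltnW.
have ratio j : (j <= q)%N -> cvg_ratio (derive1n j h) (- alpha - j%:R).
  move=> jq; rewrite -(subKn jq); elim: (q - j)%N => [|k IH].
    by rewrite subn0; exact: cvg_ratio_abs.
  have [qk|kq] := leqP q k.
    by rewrite (_ : q - k.+1 = q - k)%N// subnS; move/eqP: qk => ->.
  apply: (@cvg_ratio_primitive _ (derive1n (q - k) h) T0).
  - move=> t Tt; have := @der (q - k.+1)%N t; rewrite -subSn// subSS; apply => //.
    by rewrite leq_subr.
  - by apply: sgn; rewrite leq_subr.
  - by apply: lim; rewrite ltn_subrL.
  - by rewrite -addrA -opprD natr1 -subSn// subSS.
split.
- by exists T0 => j t jm Tt; apply: der => //; exact: leq_trans mq.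
- move=> j jm; have := leq_trans jm mq; rewrite leq_eqVlt => /predU1P[jq|jq].
    (* [j <= m <= q] and [j = q] force [m = q], so [m < omega] makes the fractional part [omega - q]
       positive. *)
    rewrite jq; apply: (@slow_at_Delta _ (omega - q%:R)).
    + rewrite subr_gt0; apply: le_lt_trans mom; rewrite ler_nat -jq//.
    + by exists T1.
    + apply: hD; rewrite subr_gt0; apply: le_lt_trans mom; rewrite ler_nat -jq//.
  have [sg sg1 [T [fT1 fT2 _]]] :=
    ult_sign_nonincr_abs (fun t => @der j t jq) (sgn j.+1 jq) (lim j jq).
  exact: slow_at_nonincr_abs fT1 sg1 fT2 (ratio j (ltnW jq)).
- by have := ratio 0%N (leq0n _); rewrite subr0.
Qed.

End SmoothVariation.

(** * Potter bounds and the Taylor expansion of the tail *)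

Section TailBounds.
Variable R : realType.
Implicit Types (f g df : R -> R) (t x y l T rho eps sg alpha omega : R).

(** Repeated halving brings any [t] into the octave [[T, 2 T]]. This lets one limiting ratio, that
    of [l = 2], suffice for Potter's bounds. *)
Lemma dyadic_bound (phi : R -> R) T (M : R) : 0 < T ->
  (forall t, T <= t -> phi (2 * t) <= phi t) ->
  (forall t, T <= t -> t <= 2 * T -> phi t <= M) ->
  forall t, T <= t -> phi t <= M.
Proof.
move=> T0 h2 hM t Tt.
have [n tn] : exists n, t <= 2 ^+ n * T.
  have [n nt] : exists n : nat, t / T < n%:R.
    by exists (Num.truncn (t / T)).+1; exact: truncnS_gt.
  exists n; rewrite -ler_pdivrMr//; apply: (le_trans (ltW nt)).
  by rewrite -natrX ler_nat ltnW// ltn_expl.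
elim: n t Tt tn => [|n IH] t Tt tn; first by apply: hM => //; rewrite expr0 in tn; lra.
have [t2|t2] := leP t (2 * T); first exact: hM.
have -> : t = 2 * (t / 2) by field.
have Tt2 : T <= t / 2 by lra.
apply: (le_trans (h2 _ Tt2)); apply: IH => //.
by move: tn; rewrite exprS; lra.
Qed.

(** As [beta < alpha], eventually [h (2 t) <= 2^(-beta) h t], so [t^beta h t] does not grow under
    doubling. Up to [2 T] the bound [h <= 1] takes over. Validity at every [x > 0] matters: the
    bound is applied at [d t / n], which may be small. *)
Lemma potter_upper (h : R -> R) alpha (beta : R) : 0 < beta -> beta < alpha ->
  (forall x y, x <= y -> h y <= h x) -> (forall x, 0 < h x <= 1) ->
  cvg_ratio h (- alpha) ->
  exists2 C : R, 0 < C & forall x, 0 < x -> h x <= C * x `^ (- beta).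
Proof.
move=> b0 ba hn h01 hr.
have h0 x : 0 < h x by have /andP[] := h01 x.
have e0 : 0 < 2 `^ (- beta) - 2 `^ (- alpha) :> R.
  rewrite subr_gt0 /powR pnatr_eq0/= ltr_expR ltr_pM2r ?ltrN2//.
  by rewrite ln_gt0// ltr1n.
have /cvg_pinfty_distP/(_ _ e0)[T1 hT1] := hr 2 (ltr0Sn _ 1).
pose T : R := Num.max (T1 + 1) 1.
have T0 : 0 < T by rewrite lt_max ltr01 orbT.
have pE x : 0 < x -> x `^ beta * x `^ (- beta) = 1.
  by move=> x0; rewrite powRN divff// gt_eqF// powR_gt0.
have dec t : T <= t -> (2 * t) `^ beta * h (2 * t) <= t `^ beta * h t.
  rewrite ge_max => /andP[T1t t1].
  have t0 : 0 < t by lra.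
  have /hT1 : T1 < t by lra.
  rewrite ler_norml => /andP[_ hh].
  have {}hh : h (2 * t) / h t <= 2 `^ (- beta) by lra.
  move: hh; rewrite ler_pdivrMr// => hh.
  rewrite powRM ?(ltW t0)//.
  rewrite (mulrC (2 `^ beta)) -mulrA ler_pM2l ?powR_gt0//.
  have -> : h t = 2 `^ beta * (2 `^ (- beta) * h t) by rewrite mulrA pE// mul1r.
  by rewrite ler_pM2l// powR_gt0.
pose M := (2 * T) `^ beta.
have bd := @dyadic_bound (fun t => t `^ beta * h t) T M T0 dec.
have M0 : 0 < M by rewrite powR_gt0// mulr_gt0.
exists M => // x x0.
suff : x `^ beta * h x <= M.
  move=> hx; rewrite -(ler_pM2l (powR_gt0 beta x0)) mulrCA pE// mulr1//.
have small t : 0 < t -> t <= 2 * T -> t `^ beta * h t <= M.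
  move=> t0 t2; rewrite -[leRHS]mulr1; apply: ler_pM; rewrite ?powR_ge0 ?(ltW (h0 _))//.
    by apply: ge0_ler_powR; rewrite ?nnegrE ?(ltW b0) ?(ltW t0) ?mulr_ge0// ltW.
  by have /andP[] := h01 t.
have [Tx|xT] := leP T x; last by apply: small => //; lra.
apply: bd => // t Tt; apply: small; lra.
Qed.

(** Mirror image of [potter_upper]: [t^beta h t] does not decrease under doubling, and its opposite
    is fed to [dyadic_bound]. *)
Lemma potter_lower (h : R -> R) alpha (beta : R) : 0 < beta -> alpha < beta ->
  (forall x y, x <= y -> h y <= h x) -> (forall x, 0 < h x) ->
  cvg_ratio h (- alpha) ->
  exists2 C : R, 0 < C & exists T : R, forall t, T < t -> C * t `^ (- beta) <= h t.
Proof.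
move=> b0 ba hn h0 hr.
have e0 : 0 < 2 `^ (- alpha) - 2 `^ (- beta) :> R.
  rewrite subr_gt0 /powR pnatr_eq0/= ltr_expR ltr_pM2r ?ltrN2//.
  by rewrite ln_gt0// ltr1n.
have /cvg_pinfty_distP/(_ _ e0)[T1 hT1] := hr 2 (ltr0Sn _ 1).
pose T : R := Num.max (T1 + 1) 1.
have T0 : 0 < T by rewrite lt_max ltr01 orbT.
have pE x : 0 < x -> x `^ beta * x `^ (- beta) = 1.
  by move=> x0; rewrite powRN divff// gt_eqF// powR_gt0.
have dec t : T <= t -> - ((2 * t) `^ beta * h (2 * t)) <= - (t `^ beta * h t).
  rewrite ge_max => /andP[T1t t1].
  have t0 : 0 < t by lra.
  have /hT1 : T1 < t by lra.
  rewrite ler_norml => /andP[hh _].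
  have {}hh : 2 `^ (- beta) <= h (2 * t) / h t by lra.
  move: hh; rewrite ler_pdivlMr// => hh.
  rewrite lerN2 powRM ?(ltW t0)//.
  rewrite (mulrC (2 `^ beta)) -mulrA ler_pM2l ?powR_gt0//.
  have -> : h t = 2 `^ beta * (2 `^ (- beta) * h t) by rewrite mulrA pE// mul1r.
  by rewrite ler_pM2l// powR_gt0.
(* On [[T, 2 T]] the factor [t^beta] is least at [T] and [h] is least at [2 T]. *)
pose M := T `^ beta * h (2 * T).
have bd := @dyadic_bound (fun t => - (t `^ beta * h t)) T (- M) T0 dec.
exists M; first by rewrite mulr_gt0// powR_gt0.
exists T => x Tx; have x0 : 0 < x by exact: lt_trans Tx.
rewrite -(ler_pM2l (powR_gt0 beta x0)) mulrCA pE// mulr1 -lerN2.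
apply: bd (ltW Tx) => t Tt t2; rewrite lerN2 ler_pM ?powR_ge0 ?(ltW (h0 _)) ?hn//.
by apply: ge0_ler_powR; rewrite ?nnegrE ?(ltW b0) ?(ltW T0)// (le_trans (ltW T0)).
Qed.

(** Slow variation of order [j] bounds the increment over [[t (1 - d), t]] by the value at [t]; the
    mean value theorem reads it as [t d] times the next derivative at some [c], and slow variation
    of that derivative moves [c] to [t] at the price of a factor 2. *)
Lemma deriv_tail_bound (h : R -> R) (m : nat) :
  (exists T : R, forall j t, (j < m)%N -> T < t ->
        is_derive t 1 (derive1n j h) (derive1n j.+1 h t)) ->
  (forall j, (j <= m)%N -> slow_at (derive1n j h)) ->
  forall j, (j <= m)%N -> exists2 C : R, 0 < C &
    exists T : R, forall t, T < t -> `|derive1n j h t| <= C * t ^- j * `|h t|.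
Proof.
move=> [T0 hd] hs; elim=> [_|j IH jm].
  by exists 1 => //; exists 0 => t _; rewrite expr0 invr1 !mul1r.
have [C C0 [T1 hT1]] := IH (ltnW jm).
have [d0 d0_gt0 [T2 hT2]] := hs _ (ltnW jm) _ (ltr01).
have [d1 d1_gt0 [T3 hT3]] := hs _ jm (1 / 2) (divr_gt0 ltr01 (ltr0Sn _ 1)).
pose d := Num.min (Num.min d0 d1) (1 / 2).
have d_gt0 : 0 < d by rewrite !lt_min d0_gt0 d1_gt0/= divr_gt0.
exists (2 * C / d); first by rewrite !mulr_gt0// invr_gt0.
have dd0 : d <= d0 by rewrite !ge_min lexx.
have dd1 : d <= d1 by rewrite !ge_min lexx orbT.
have dd2 : d <= 1 / 2 by rewrite !ge_min lexx orbT.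
exists (Num.max (Num.max T1 (2 * T0)) (Num.max T2 (Num.max T3 0))) => t.
rewrite !gt_max => /andP[/andP[T1t T0t] /and3P[T2t T3t t0]].
have Ts : T0 < t * (1 - d) by nra.
have st : t * (1 - d) <= t by nra.
have [c /andP[sc ct] e] := mvt_pinfty (fun t => @hd j t jm) Ts st.
have hj := hT2 _ (t * (1 - d)) T2t (_ : _) st; rewrite mul1r in hj.
have {}hj : `|derive1n j h (t * (1 - d)) - derive1n j h t| <= `|derive1n j h t|.
  by apply: hj; rewrite ler_pM2l//; lra.
have hc : `|derive1n j.+1 h t| <= 2 * `|derive1n j.+1 h c|.
  have : `|derive1n j.+1 h c - derive1n j.+1 h t| <= 1 / 2 * `|derive1n j.+1 h t|.
    by apply: hT3 => //; apply: le_trans sc; rewrite ler_pM2l//; lra.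
  have := ler_normD (derive1n j.+1 h c) (derive1n j.+1 h t - derive1n j.+1 h c).
  by rewrite addrC subrK (distrC (derive1n j.+1 h t)); lra.
have key : `|derive1n j.+1 h c| * (t * d) <= `|derive1n j h t|.
  move: hj; rewrite distrC e normrM (_ : t - t * (1 - d) = t * d); last by ring.
  by rewrite (gtr0_norm (mulr_gt0 t0 d_gt0)).
have hb := hT1 _ T1t.
rewrite exprS invfM; apply: (le_trans hc).
have -> : 2 * C / d * (t^-1 * t ^- j) * `|h t| = 2 * ((C * t ^- j * `|h t|) / (t * d)).
  by field; rewrite !gt_eqF// exprn_gt0.
by rewrite ler_pM2l// ler_pdivlMr ?mulr_gt0//; exact: le_trans hb.
Qed.

Definition taylor (a : nat -> R) (m : nat) (u : R) : R :=
  \sum_(j < m.+1) u ^+ j / j`!%:R * a j.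

Lemma is_derive_taylor (a : nat -> R) (m : nat) t x :
  is_derive x 1 (fun x => taylor a m.+1 (x - t)) (taylor (fun j => a j.+1) m (x - t)).
Proof.
rewrite /taylor.
have dsub : is_derive x 1 (fun x : R => x - t) 1.
  by rewrite -[X in is_derive _ _ _ X]subr0; apply: is_deriveB.
have dpow (j : nat) : is_derive x 1 (fun x : R => (x - t) ^+ j.+1 / j.+1`!%:R * a j.+1)
    ((x - t) ^+ j / j`!%:R * a j.+1).
  have d1 : is_derive x 1 (fun x : R => (x - t) ^+ j.+1) (j.+1%:R * (x - t) ^+ j).
    have := @is_deriveX _ _ (fun x : R => x - t) j.+1 x 1 1 dsub.
    by rewrite /GRing.scale/= mulr1 exprfctE.
  have := is_derive_cstM (a j.+1 / j.+1`!%:R) d1.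
  have fn0 : j`!%:R != 0 :> R by rewrite pnatr_eq0 gtn_eqF// fact_gt0.
  have -> : a j.+1 / j.+1`!%:R * (j.+1%:R * (x - t) ^+ j) = (x - t) ^+ j / j`!%:R * a j.+1.
    rewrite factS natrM; have : j.+1%:R != 0 :> R by rewrite pnatr_eq0.
    by move: (j.+1%:R : R) => k k0; field; rewrite k0 fn0.
  congr (is_derive _ _ _ _); apply/funext => y; ring.
have dsum := @is_derive_sum _ _ _ m.+1 (fun i x => (x - t) ^+ i.+1 / i.+1`!%:R * a i.+1) x 1 _ dpow.
have dcst : is_derive x 1 (fun _ : R => a 0%N) 0 by exact: is_derive_cst.
have := @is_deriveD _ _ _ _ _ _ _ _ _ dcst dsum; rewrite add0r.
congr (is_derive _ _ _ _); apply/funext => y.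
rewrite [RHS]big_ord_recl expr0 fact0 invr1 !mul1r.
by rewrite -[LHS]/(_ y + (\sum_(i < _) _) y) fct_sumE.
Qed.

Lemma taylor_at0 (a : nat -> R) (m : nat) : taylor a m 0 = a 0%N.
Proof.
rewrite /taylor big_ord_recl/= expr0 fact0 invr1 !mul1r big1 ?addr0// => i _.
by rewrite expr0n/= mul0r mul0r.
Qed.

(** The remainder is measured by the oscillation of the derivative of order [m], since order [m + 1]
    may not exist. Its derivative is the remainder of one order less for the shifted family, whence
    the induction. *)
Lemma taylor_remainder (H : nat -> R -> R) (m : nat) T t (z E : R) :
  (forall j t, (j < m)%N -> T < t -> is_derive t 1 (H j) (H j.+1 t)) ->
  T < z -> (forall x, z <= x -> x <= t -> `|H m x - H m t| <= E) ->
  forall x, z <= x -> x <= t ->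
  `|H 0%N x - taylor (fun j => H j t) m (x - t)| <= E * (t - x) ^+ m.
Proof.
elim: m H => [|m IH] H Hd Tz HE x zx xt.
  by rewrite /taylor big_ord1 !expr0 mulr1 fact0 invr1 !mul1r; exact: HE.
have {}IH := IH (fun j => H j.+1) (fun j t jm => Hd j.+1 t jm) Tz HE.
have dr y : T < y -> is_derive y 1 (fun y => H 0%N y - taylor (fun j => H j t) m.+1 (y - t))
    (H 1%N y - taylor (fun j => H j.+1 t) m (y - t)).
  by move=> Ty; apply: is_deriveB; [exact: Hd|exact: is_derive_taylor].
have [c /andP[xc ct]] := mvt_pinfty dr (lt_le_trans Tz zx) xt.
rewrite subrr taylor_at0 subrr sub0r => e.
rewrite -normrN e normrM (ger0_norm (_ : 0 <= t - x)) ?subr_ge0//.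
rewrite exprSr mulrA ler_wpM2r ?subr_ge0//.
apply: (le_trans (IH c (le_trans zx xc) ct)).
have E0 : 0 <= E.
  by apply: le_trans (HE t (le_trans zx xt) (lexx _)); rewrite normr_ge0.
by rewrite ler_wpM2l// lerXn2r ?nnegrE ?subr_ge0 ?(le_trans xc)// lerD2l lerN2.
Qed.

(** The polynomial is not cut off: its integral against the law of the walk must give the full
    moments. *)
Definition jump_rem (h : R -> R) (m : nat) (delta t y : R) : R :=
  (if y <= delta * t then h (t - y) else 0)
  - taylor (fun j => derive1n j h t) m (- y).

Lemma jump_rem_bound (h : R -> R) (m : nat) : (forall x, 0 < h x) ->
  (exists T : R, forall j t, (j < m)%N -> T < t ->
        is_derive t 1 (derive1n j h) (derive1n j.+1 h t)) ->
  (forall j, (j <= m)%N -> slow_at (derive1n j h)) ->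
  exists2 delta : R, 0 < delta <= 1 / 2 &
  (exists2 C : R, 0 < C & exists T : R, forall t y, T < t -> 0 <= y ->
     `|jump_rem h m delta t y| <= C * y ^+ m * (t ^- m * h t)) /\
  (forall y eps, 0 <= y -> 0 < eps -> exists T : R, forall t, T < t ->
     `|jump_rem h m delta t y| <= eps * (t ^- m * h t)).
Proof.
move=> h0 hd hs; have [T0 hT0] := hd.
have db := deriv_tail_bound hd hs.
have [C C0 [T1 hT1]] : exists2 C : R, 0 < C & exists T : R, forall j t, (j <= m)%N -> T < t ->
    `|derive1n j h t| <= C * t ^- j * h t.
  elim: {-2}m (leqnn m) => [|k IH] km.
    have [C C0 [T hT]] := db 0%N km.
    exists C => //; exists T => j t; rewrite leqn0 => /eqP -> Tt.
    by have := hT _ Tt; rewrite derive1n0 (gtr0_norm (h0 t)).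
  have [C1 C10 [T1 hT1]] := IH (ltnW km); have [C2 C20 [T2 hT2]] := db _ km.
  exists (Num.max C1 C2); first by rewrite lt_max C10.
  exists (Num.max 0 (Num.max T1 T2)) => j t jk1; rewrite !gt_max => /and3P[t0 Tt1 Tt2]; move: jk1.
  have p0 i : 0 <= t ^- i by rewrite invr_ge0 exprn_ge0// ltW.
  rewrite leq_eqVlt ltnS => /predU1P[->|jk].
    apply: (le_trans (hT2 _ Tt2)); rewrite (gtr0_norm (h0 t)) ler_wpM2r ?(ltW (h0 _))//.
    by rewrite ler_wpM2r// le_max lexx orbT.
  apply: (le_trans (hT1 _ _ jk Tt1)).
  by rewrite ler_wpM2r ?(ltW (h0 _))// ler_wpM2r// le_max lexx.
(* Used twice: with [eps = 1] for the bound uniform in [y], and with a small [eps] for fixed [y]. *)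
have Tay eps d T t y : 0 < eps -> 0 < d -> d <= 1 / 2 ->
    (forall t s, T < t -> t * (1 - d) <= s -> s <= t ->
      `|derive1n m h s - derive1n m h t| <= eps * `|derive1n m h t|) ->
    0 < t -> T < t -> T1 < t -> 2 * T0 < t -> 0 <= y -> y <= d * t ->
    `|h (t - y) - taylor (fun j => derive1n j h t) m (- y)| <= eps * C * y ^+ m * (t ^- m * h t).
  move=> e0 d0 d1 hT t0 Tt T1t T0t y0 yd.
  have := @taylor_remainder (fun j => derive1n j h) m T0 t (t * (1 - d)) (eps * `|derive1n m h t|) hT0.
  have Tz : T0 < t * (1 - d) by nra.
  move=> /(_ Tz (fun x => hT t x Tt) (t - y)).
  have -> : t - y - t = - y by ring.
  have -> : t - (t - y) = y by ring.
  rewrite derive1n0 => h1; apply: (le_trans (h1 _ _)); [lra|lra|].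
  have := hT1 m t (leqnn m) T1t => h2.
  have -> : eps * C * y ^+ m * (t ^- m * h t) = eps * (C * t ^- m * h t) * y ^+ m by ring.
  by rewrite ler_wpM2r ?exprn_ge0// ler_pM2l.
have [d d0 [T2 hT2]] := hs m (leqnn m) 1 ltr01.
pose delta := Num.min d (1 / 2).
have dl0 : 0 < delta by rewrite lt_min d0 divr_gt0.
have dld : delta <= d by rewrite ge_min lexx.
have dl1 : delta <= 1 / 2 by rewrite ge_min lexx orbT.
exists delta; first by rewrite dl0 dl1.
have hT2' t s : T2 < t -> t * (1 - delta) <= s -> s <= t -> 0 < t ->
    `|derive1n m h s - derive1n m h t| <= 1 * `|derive1n m h t|.
  move=> T2t st1 st2 t0; apply: hT2 => //; apply: le_trans st1.
  by rewrite ler_pM2l//; lra.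
split.
(* [C] covers the Taylor remainder up to the cutoff. Beyond it [y / t >= delta], so each of the
   [m + 1] terms of the polynomial satisfies [(y / t)^j <= delta^-m (y / t)^m]. *)
- exists (C + m.+1%:R * C * delta ^- m); first by rewrite addr_gt0// !mulr_gt0// invr_gt0 exprn_gt0.
  exists (Num.max 0 (Num.max T1 (Num.max (2 * T0) T2))) => t y.
  rewrite !gt_max => /and4P[t0 T1t T0t T2t] y0.
  have D0 : 0 <= t ^- m * h t by rewrite mulr_ge0 ?invr_ge0 ?exprn_ge0 ?ltW.
  have dm0 : 0 <= delta ^- m by rewrite invr_ge0 exprn_ge0// ltW.
  rewrite /jump_rem; case: ifPn => [yd|].
    have := @Tay 1 delta (Num.max T2 0) t y ltr01 dl0 dl1 _ t0 _ T1t T0t y0 yd.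
    rewrite mul1r => hh; apply: (le_trans (hh _ _)).
    + by move=> t' s'; rewrite gt_max => /andP[? ?] ? ?; exact: hT2'.
    + by rewrite gt_max T2t.
    + by rewrite ler_wpM2r// ler_wpM2r ?exprn_ge0// lerDl !mulr_ge0// ltW.
  rewrite -ltNge => yd; rewrite sub0r normrN.
  have yt1 : delta <= y / t by rewrite ler_pdivlMr// ltW.
  have yt0 : 0 < y / t by exact: lt_le_trans yt1.
  apply: (@le_trans _ _ (\sum_(j < m.+1) C * delta ^- m * y ^+ m * (t ^- m * h t))).
    rewrite /taylor; apply: (le_trans (ler_norm_sum _ _ _)); apply: ler_sum => j _.
    have jm : (j <= m)%N by rewrite -ltnS.
    have := hT1 j t jm T1t => hj.
    rewrite !normrM normrX normrN (ger0_norm y0) normfV (ger0_norm (ler0n _ _)).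
    apply: (@le_trans _ _ (y ^+ j * (C * t ^- j * h t))).
      apply: ler_pM => //; first by rewrite mulr_ge0 ?exprn_ge0 ?invr_ge0.
      rewrite -[leRHS]mulr1 ler_wpM2l ?exprn_ge0// invf_le1 ?ler1n ?fact_gt0// ltr0n fact_gt0//.
    have -> : y ^+ j * (C * t ^- j * h t) = C * h t * (y / t) ^+ j.
      by rewrite expr_div_n; ring.
    have -> : C * delta ^- m * y ^+ m * (t ^- m * h t) = C * h t * (delta ^- m * (y / t) ^+ m).
      by rewrite expr_div_n; ring.
    rewrite ler_wpM2l ?mulr_ge0 ?(ltW C0) ?(ltW (h0 _))//.
    rewrite [leRHS]mulrC ler_pdivlMr ?exprn_gt0// -[in leRHS](subnKC jm) exprD ler_pM2l ?exprn_gt0//.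
    apply: (@le_trans _ _ (delta ^+ (m - j))).
      by rewrite ler_wiXn2l ?leq_subr// ?ltW//; lra.
    by rewrite lerXn2r ?nnegrE ?(ltW dl0) ?(ltW yt0).
  rewrite sumr_const card_ord -[leLHS]mulr_natl.
  have -> : m.+1%:R * (C * delta ^- m * y ^+ m * (t ^- m * h t)) =
    m.+1%:R * C * delta ^- m * y ^+ m * (t ^- m * h t) by ring.
  by rewrite ler_wpM2r// ler_wpM2r ?exprn_ge0// lerDr ltW.
- move=> y eps y0 e0.
  (* The summand 1 keeps the denominator positive when [C * y ^+ m] vanishes. *)
  pose e := eps / (C * y ^+ m + 1).
  have Cy0 : 0 <= C * y ^+ m by rewrite mulr_ge0 ?exprn_ge0// ltW.
  have Cy1 : 0 < C * y ^+ m + 1 by rewrite ltr_wpDl.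
  have e_gt0 : 0 < e by rewrite divr_gt0.
  have [d' d'0 [T3 hT3]] := hs m (leqnn m) e e_gt0.
  pose d2 := Num.min d' delta.
  have d20 : 0 < d2 by rewrite lt_min d'0.
  have d2d' : d2 <= d' by rewrite ge_min lexx.
  have d2d : d2 <= delta by rewrite ge_min lexx orbT.
  exists (Num.max 0 (Num.max T1 (Num.max (2 * T0) (Num.max T3 (y / d2))))) => t.
  rewrite !gt_max => /and5P[t0 T1t T0t T3t]; rewrite ltr_pdivrMr// mulrC => yd2.
  have yd : y <= delta * t by rewrite (le_trans (ltW yd2))// ler_pM2r.
  rewrite /jump_rem yd.
  have D0 : 0 <= t ^- m * h t by rewrite mulr_ge0 ?invr_ge0 ?exprn_ge0 ?ltW.
  have := @Tay e d2 (Num.max T3 0) t y e_gt0 d20 (le_trans d2d dl1) _ t0 _ T1t T0t y0 (ltW yd2).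
  move=> hh; apply: (le_trans (hh _ _)).
  + move=> t' s'; rewrite gt_max => /andP[? ?] st1 ?; apply: hT3 => //.
    by apply: le_trans st1; rewrite ler_pM2l//; lra.
  + by rewrite gt_max T3t.
  + rewrite ler_wpM2r// -mulrA /e mulrAC ler_pdivrMr// ler_pM2l//; lra.
Qed.

End TailBounds.

(** * Laws of partial sums and weighted translation operators *)

Section ConvolutionPower.
Variable R : realType.
Implicit Types (mu : probability R R) (f g w v : R -> \bar R).
Local Open Scope ereal_scope.

Definition sum_pair (z : R * R) : R := (z.1 + z.2)%R.

Lemma measurable_sum_pair : measurable_fun setT sum_pair.
Proof. by apply: measurable_funD. Qed.

HB.instance Definition _ := isMeasurableFun.Build _ _ _ _ sum_pair measurable_sum_pair.

(** The law of [S_n] as a measure, so that product measures and dominated convergence apply where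
    [conv_int] offers only iterated integrals. *)
Fixpoint sum_law mu (n : nat) : probability R R :=
  match n with
  | 0%N => \d_(0%R : R)
  | n'.+1 => distribution (mu \x sum_law mu n') sum_pair
  end.

Lemma measurable_shift f (x : R) : measurable_fun setT f ->
  measurable_fun setT (fun y => f (x + y)%R).
Proof. by move=> mf; apply: measurableT_comp => //; exact: measurable_funD. Qed.

Lemma measurable_shift2 f (x : R) : measurable_fun setT f ->
  measurable_fun setT (fun z : R * R => f (x + z.1 + z.2)%R).
Proof.
move=> mf; apply: measurableT_comp => //; apply: measurable_funD => //.
exact: measurable_funD.
Qed.

Lemma ge0_integral_sum_lawS mu n f : measurable_fun setT f -> (forall x, 0 <= f x) ->
  \int[sum_law mu n.+1]_y f y = \int[mu]_x \int[sum_law mu n]_y f (x + y)%R.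
Proof.
move=> mf f0 /=; rewrite ge0_integral_distribution//.
rewrite fubini_tonelli1//=; exact: measurableT_comp.
Qed.

Lemma integral_sum_law0 mu f : measurable_fun setT f -> 
  \int[sum_law mu 0]_y f y = f 0%R.
Proof. by move=> mf; rewrite /= integral_dirac// diracT mul1e. Qed.

(** The shift [x] is kept general because each induction step absorbs one summand into it. *)
Lemma ge0_conv_int mu n (g : R -> R) (x : R) : measurable_fun setT g -> (forall x, 0 <= g x)%R ->
  conv_int mu n (fun y => g (x + y)%R) = \int[sum_law mu n]_y (g (x + y)%R)%:E.
Proof.
move=> mg g0; have mEg : measurable_fun setT (EFin \o g) by exact/measurable_EFinP.
elim: n x => [|n IH] x /=.
  by rewrite integral_sum_law0//; exact: (measurable_shift x mEg).
rewrite (@ge0_integral_sum_lawS mu n (fun y => (g (x + y)%R)%:E)).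
- by apply: eq_integral => y _; under eq_fun do rewrite addrA; rewrite IH; under eq_integral do rewrite -addrA.
- exact: (measurable_shift x mEg).
- by move=> y; rewrite lee_fin.
Qed.

Section Shift.
Variable mu : probability R R.

(** One step of the walk in which a jump [y] counts with weight [w y]; indicator weights restrict
    the size of the jump. *)
Definition shift_int w f (x : R) : \bar R := \int[mu]_y (w y * f (x + y)%R).

Section Props.
Variables w v : R -> \bar R.
Hypotheses (mw : measurable_fun setT w) (w0 : forall y, 0 <= w y).
Hypotheses (mv : measurable_fun setT v) (v0 : forall y, 0 <= v y).

Lemma shift_int_ge0 f : (forall x, 0 <= f x) -> forall x, 0 <= shift_int w f x.
Proof. by move=> f0 x; apply: integral_ge0 => y _; rewrite mule_ge0. Qed.

Lemma measurable_shift_int f : measurable_fun setT f -> (forall x, 0 <= f x) ->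
  measurable_fun setT (shift_int w f).
Proof.
move=> mf f0.
apply: (measurable_fun_fubini_tonelli_F (fun z : R * R => w z.2 * f (z.1 + z.2)%R)).
  apply: emeasurable_funM; first exact: measurableT_comp.
  by apply: measurableT_comp => //; exact: measurable_funD.
by move=> z; rewrite mule_ge0.
Qed.

Lemma measurable_weight f x : measurable_fun setT f -> measurable_fun setT (fun y => w y * f (x + y)%R).
Proof. by move=> mf; apply: emeasurable_funM => //; exact: measurable_shift. Qed.

Lemma le_shift_int f g : measurable_fun setT f -> (forall x, 0 <= f x) ->
  measurable_fun setT g -> (forall x, f x <= g x) ->
  forall x, shift_int w f x <= shift_int w g x.
Proof.
move=> mf f0 mg fg x; apply: ge0_le_integral => //.
- by move=> y _; rewrite mule_ge0.
- exact: measurable_weight.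
- exact: measurable_weight.
- by move=> y _; rewrite lee_wpmul2l.
Qed.

Lemma shift_intD f g : measurable_fun setT f -> (forall x, 0 <= f x) ->
  measurable_fun setT g -> (forall x, 0 <= g x) ->
  shift_int w (f \+ g) = shift_int w f \+ shift_int w g.
Proof.
move=> mf f0 mg g0; apply/funext => x; rewrite /shift_int/= -ge0_integralD//.
- by apply: eq_integral => y _; rewrite ge0_muleDr.
- by move=> y _; rewrite mule_ge0.
- exact: measurable_weight.
- by move=> y _; rewrite mule_ge0.
- exact: measurable_weight.
Qed.

Lemma shift_intZ (k : R) f : (0 <= k)%R -> measurable_fun setT f -> (forall x, 0 <= f x) ->
  shift_int w (fun x => k%:E * f x) = fun x => k%:E * shift_int w f x.
Proof.
move=> k0 mf f0; apply/funext => x; rewrite /shift_int -ge0_integralZl ?lee_fin//.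
- by apply: eq_integral => y _; rewrite muleCA.
- exact: measurable_weight.
- by move=> y _; rewrite mule_ge0.
Qed.

Lemma shift_int_cst (k : R) x : (0 <= k)%R ->
  shift_int w (fun=> k%:E) x = k%:E * \int[mu]_y w y.
Proof.
move=> k0; rewrite /shift_int -ge0_integralZl ?lee_fin//.
by apply: eq_integral => y _; rewrite muleC.
Qed.

(** By Tonelli and commutativity of addition, the order in which two weighted jumps occur does not
    matter. *)
Lemma shift_intC f : measurable_fun setT f -> (forall x, 0 <= f x) ->
  shift_int w (shift_int v f) = shift_int v (shift_int w f).
Proof.
move=> mf f0; apply/funext => x; rewrite /shift_int.
transitivity (\int[mu]_y \int[mu]_z (w y * (v z * f (x + y + z)%R))).
  apply: eq_integral => y _; rewrite -ge0_integralZl//.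
  - by apply: emeasurable_funM => //; exact: measurable_shift.
  - by move=> z _; rewrite mule_ge0.
rewrite (fubini_tonelli (fun z : R * R => w z.1 * (v z.2 * f (x + z.1 + z.2)%R))); first last.
- by move=> z; rewrite !mule_ge0.
- apply: emeasurable_funM; first exact: measurableT_comp.
  apply: emeasurable_funM; first exact: measurableT_comp.
  exact: measurable_shift2.
apply: eq_integral => z _; rewrite -ge0_integralZl//.
- by apply: eq_integral => y _; rewrite muleCA/= addrAC.
- exact: measurable_weight.
- by move=> y _; rewrite mule_ge0.
Qed.

Lemma shift_int_weightD f : measurable_fun setT f -> (forall x, 0 <= f x) ->
  shift_int (w \+ v) f = shift_int w f \+ shift_int v f.
Proof.
move=> mf f0; apply/funext => x; rewrite /shift_int/= -ge0_integralD//.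
- by apply: eq_integral => y _; rewrite ge0_muleDl.
- by move=> y _; rewrite mule_ge0.
- exact: measurable_weight.
- by move=> y _; rewrite mule_ge0.
- by apply: emeasurable_funM => //; exact: measurable_shift.
Qed.
End Props.

Lemma iter_shift_int_law n f x : measurable_fun setT f -> (forall x, 0 <= f x) ->
  iter n (shift_int (cst 1)) f x = \int[sum_law mu n]_y f (x + y)%R.
Proof.
move=> mf f0; elim: n x => [|n IH] x.
  by rewrite integral_sum_law0 ?addr0//; exact: measurable_shift.
rewrite iterS ge0_integral_sum_lawS//; last exact: measurable_shift.
rewrite /shift_int; apply: eq_integral => y _.
by rewrite mul1e IH; apply: eq_integral => z _; rewrite addrA.
Qed.
End Shift.
End ConvolutionPower.

(** * The principle of one big jump, with an explicit error *)

Section BigJump.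
Variable R : realType.
Variable mu : probability R R.
Implicit Types (f g w v : R -> \bar R).
Local Open Scope ereal_scope.

Definition tail (t : R) : R := (1 - distr_fun mu t)%R.

Lemma tailE t : (tail t)%:E = mu `]t, +oo[%classic.
Proof.
have -> : `]t, +oo[%classic = ~` `]-oo, t]%classic by rewrite setCitvl.
rewrite probability_setC// /tail /distr_fun EFinB fineK// fin_num_measure//.
Qed.

Lemma tail_ge0 t : (0 <= tail t)%R.
Proof. by rewrite -lee_fin tailE. Qed.

Lemma tail_le1 t : (tail t <= 1)%R.
Proof. by rewrite -lee_fin tailE probability_le1. Qed.

Lemma tail_nonincr x y : (x <= y)%R -> (tail y <= tail x)%R.
Proof.
move=> xy; rewrite -lee_fin !tailE; apply: le_measure; rewrite ?inE//.
by apply: subset_itvr; rewrite bnd_simp.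
Qed.

Section Truncation.
Variable u : R.

Let wA : R -> \bar R := EFin \o \1_(`]-oo, u]%classic).
Let wB : R -> \bar R := EFin \o \1_(`]u, +oo[%classic).

Let mwA : measurable_fun setT wA.
Proof. exact/measurable_EFinP. Qed.
Let mwB : measurable_fun setT wB.
Proof. exact/measurable_EFinP. Qed.
Let wA0 y : 0 <= wA y. Proof. by rewrite lee_fin. Qed.
Let wB0 y : 0 <= wB y. Proof. by rewrite lee_fin. Qed.

Let wAB : cst 1 = wA \+ wB.
Proof.
apply/funext => y; rewrite /wA /wB /= -EFinD !indicE !mem_setE !in_itv/= andbT.
by case: leP; rewrite ?addr0 ?add0r.
Qed.

Let int_wB : \int[mu]_y wB y = (tail u)%:E.
Proof. by rewrite /wB integral_indic// setIT tailE. Qed.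

Let int_wA : \int[mu]_y wA y <= 1.
Proof. by rewrite /wA integral_indic// setIT probability_le1. Qed.

(* [T] adds one summand, [A] a summand at most [u], [B] a larger one.  [A] and [B]
   commute, so that [T^n = (A + B)^n = A^n + n A^(n-1) B] up to two large jumps. *)
Let T := shift_int mu (cst 1).
Let A := shift_int mu wA.
Let B := shift_int mu wB.

Let nice f := measurable_fun setT f /\ forall x, 0 <= f x.

Let niceT f : nice f -> nice (T f).
Proof. by move=> [mf f0]; split; [exact: measurable_shift_int|exact: shift_int_ge0]. Qed.
Let niceA f : nice f -> nice (A f).
Proof. by move=> [mf f0]; split; [exact: measurable_shift_int|exact: shift_int_ge0]. Qed.
Let niceB f : nice f -> nice (B f).
Proof. by move=> [mf f0]; split; [exact: measurable_shift_int|exact: shift_int_ge0]. Qed.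
Let nice_iterT n f : nice f -> nice (iter n T f).
Proof. by move=> nf; elim: n => //= n; exact: niceT. Qed.
Let nice_iterA n f : nice f -> nice (iter n A f).
Proof. by move=> nf; elim: n => //= n; exact: niceA. Qed.
Let nice_cst (k : R) : (0 <= k)%R -> nice (fun=> k%:E).
Proof. by split. Qed.
Let niceD f g : nice f -> nice g -> nice (f \+ g).
Proof.
by move=> [mf f0] [mg g0]; split; [exact: emeasurable_funD|move=> x; rewrite adde_ge0].
Qed.
Let niceZ (k : R) f : (0 <= k)%R -> nice f -> nice (fun x => k%:E * f x).
Proof.
move=> k0 [mf f0]; split; first exact: emeasurable_funM.
by move=> x; rewrite mule_ge0.
Qed.

Let TAB f : nice f -> T f = A f \+ B f.
Proof. by move=> [mf f0]; rewrite /T wAB shift_int_weightD. Qed.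

Let BA n f : nice f -> B (iter n A f) = iter n A (B f).
Proof.
move=> nf; elim: n => //= n IH.
by have [? ?] := nice_iterA n nf; rewrite -IH /A /B shift_intC.
Qed.

Let leT f g : nice f -> nice g -> (forall x, f x <= g x) -> forall x, T f x <= T g x.
Proof. by move=> [mf f0] [mg g0] fg x; exact: le_shift_int. Qed.
Let leB f g : nice f -> nice g -> (forall x, f x <= g x) -> forall x, B f x <= B g x.
Proof. by move=> [mf f0] [mg g0] fg x; exact: le_shift_int. Qed.

Let Bk f (k : R) : (0 <= k)%R -> nice f -> (forall x, f x <= k%:E) ->
  forall x, B f x <= (k * tail u)%:E.
Proof.
move=> k0 nf fk x; apply: (le_trans (leB nf (nice_cst k0) fk x)).
by rewrite /B shift_int_cst// int_wB -EFinM.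
Qed.

Let iterAk n f (k : R) : (0 <= k)%R -> nice f -> (forall x, f x <= k%:E) ->
  forall x, iter n A f x <= k%:E.
Proof.
move=> k0 [mf f0] fk; elim: n => //= n IH x.
have [? ?] := nice_iterA n (conj mf f0).
apply: (@le_trans _ _ (A (fun=> k%:E) x)); first exact: le_shift_int.
by rewrite /A shift_int_cst// -[leRHS]mule1 lee_wpmul2l// lee_fin.
Qed.

Let Tcst (k : R) x : (0 <= k)%R -> T (fun=> k%:E) x = k%:E.
Proof.
move=> k0; rewrite /T shift_int_cst//.
have -> : \int[mu]_y cst 1%E y = 1 by rewrite integral_cst// mul1e; exact: probability_setT.
by rewrite mule1.
Qed.

Let TD f g : nice f -> nice g -> T (f \+ g) = T f \+ T g.
Proof. by move=> [? ?] [? ?]; rewrite /T shift_intD. Qed.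
Let TZ (k : R) f : (0 <= k)%R -> nice f -> T (fun x => k%:E * f x) = fun x => k%:E * T f x.
Proof. by move=> ? [? ?]; rewrite /T shift_intZ. Qed.

Let fin01 (x : \bar R) (k : R) : 0 <= x -> x <= k%:E -> exists2 r : R, (0 <= r <= k)%R & x = r%:E.
Proof.
by move: x => [r| |]//; rewrite !lee_fin => r0 rk; exists r; rewrite ?r0 ?rk.
Qed.

(** Another step [A + B] turns the no-jump term into one new single-jump term, and each of the
    [n + 1] old single-jump terms into a two-jump term of size at most [tail u ^+ 2]. The error thus
    grows by [n + 1] such terms, less than the difference of consecutive squares. *)
Lemma iter_shift_two_jumps n f x : measurable_fun setT f ->
  (forall x, 0 <= f x) -> (forall x, f x <= 1) ->
  n.+1%:R%:E * iter n A (B f) x <= iter n.+1 T f x /\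
  iter n.+1 T f x <= iter n.+1 A f x +
    (n.+1%:R%:E * iter n A (B f) x + (n.+1%:R ^+ 2 * tail u ^+ 2)%:E).
Proof.
move=> mf f0 f1; have nf : nice f by [].
have nBf : nice (B f) by exact: niceB.
have u0 := tail_ge0 u.
(* The lower bound must retain the no-jump term, which produces the new single-jump term at the next
   step. *)
suff : iter n.+1 A f x + n.+1%:R%:E * iter n A (B f) x <= iter n.+1 T f x /\
  iter n.+1 T f x <= iter n.+1 A f x +
    (n.+1%:R%:E * iter n A (B f) x + (n.+1%:R ^+ 2 * tail u ^+ 2)%:E).
  move=> [h1 h2]; split => //; apply: le_trans h1; rewrite leeDr//.
  by have [_] := nice_iterA n.+1 nf; apply.
elim: n x => [|n IH] x.
  rewrite /= TAB//= mul1e; split => //; rewrite leeD2l// leeDl// lee_fin.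
  by rewrite mulr_ge0// exprn_ge0.
pose a := iter n.+1 A f; pose b := iter n A (B f).
have na : nice a by exact: nice_iterA.
have nb : nice b by exact: nice_iterA.
have Ta : T a x = A a x + A b x.
  by rewrite TAB//= /a BA.
have Bb : exists2 r : R, (0 <= r <= tail u ^+ 2)%R & B b x = r%:E.
  apply: fin01; first by have [_] := niceB nb; apply.
  rewrite expr2; apply: Bk => // y; apply: iterAk => // z.
  by have := Bk ler01 nf f1 z; rewrite mul1r.
have Ab : exists2 r : R, (0 <= r <= tail u)%R & A b x = r%:E.
  apply: fin01; first by have [_] := niceA nb; apply.
  rewrite -[A b]/(iter n.+1 A (B f)); apply: iterAk => // z.
  by have := Bk ler01 nf f1 z; rewrite mul1r.
have n0 : (0 <= n.+1%:R :> R)%R by [].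
have nnb : nice (fun x => n.+1%:R%:E * b x) by exact: niceZ.
have Tb : T (fun x => n.+1%:R%:E * b x) x = n.+1%:R%:E * (A b x + B b x).
  by rewrite TZ// TAB.
have [p p0 pE] := Ab; have [r r0 rE] := Bb.
have c0 : (0 <= n.+1%:R ^+ 2 * tail u ^+ 2)%R by rewrite mulr_ge0// exprn_ge0.
rewrite -[iter n.+2 T f x]/(T (iter n.+1 T f) x) -[iter n.+2 A f x]/(A a x).
rewrite -[iter n.+1 A (B f) x]/(A b x) pE; split.
  apply: (@le_trans _ _ (T (a \+ (fun x => n.+1%:R%:E * b x)) x)).
    rewrite TD// -[X in _ <= X]/(T a x + T _ x) Ta Tb pE rE.
    rewrite -!EFinD -!EFinM.
    rewrite -(addeA (A a x)).
    apply: leeD2l.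
    rewrite -EFinD lee_fin.
    rewrite -(natr1 n.+1).
    by move/andP: p0 => [p0 _]; move/andP: r0 => [r0 _]; nra.
  apply: leT; [exact: niceD|exact: nice_iterT|].
  by move=> y; have [] := IH y.
apply: (@le_trans _ _ (T (a \+ ((fun x => n.+1%:R%:E * b x) \+ cst (n.+1%:R ^+ 2 * tail u ^+ 2)%:E)) x)).
  apply: leT; first exact: nice_iterT.
    by apply: niceD => //; apply: niceD => //; exact: nice_cst.
  by move=> y; have [] := IH y.
have nc := nice_cst c0.
rewrite TD//; last exact: niceD.
rewrite -[X in X <= _]/(T a x + T ((fun x => n.+1%:R%:E * b x) \+ (fun=> (n.+1%:R ^+ 2 * tail u ^+ 2)%:E)) x).
rewrite (TD nnb nc) -[X in _ + X <= _]/(T (fun x => n.+1%:R%:E * b x) x + T (fun=> (n.+1%:R ^+ 2 * tail u ^+ 2)%:E) x).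
rewrite Ta Tb Tcst// pE rE.
rewrite -(addeA (A a x)); apply: leeD2l; rewrite -EFinD -!EFinM -!EFinD lee_fin.
rewrite -(natr1 n.+1); set k := (n.+1%:R : R).
have k0 : (0 <= k)%R by [].
by move/andP: p0 => [p0 _]; move/andP: r0 => [r0 r1]; nra.
Qed.

(** Each of the [n] steps is replaced by a truncated one; the discarded large jump has probability
    [tail u] and carries a value at most [k]. *)
Lemma iter_shift_one_jump n g (k : R) x : (0 <= k)%R -> measurable_fun setT g ->
  (forall x, 0 <= g x) -> (forall x, g x <= k%:E) ->
  iter n A g x <= iter n T g x /\
  iter n T g x <= iter n A g x + (n%:R * (k * tail u))%:E.
Proof.
move=> k0 mg g0 gk; have ng : nice g by [].
have u0 := tail_ge0 u.
elim: n x => [|n IH] x; first by rewrite mul0r adde0.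
have na : nice (iter n A g) by exact: nice_iterA.
rewrite !iterS; split.
  apply: (@le_trans _ _ (T (iter n A g) x)).
    by rewrite TAB//= leeDl//; have [_] := niceB na; apply.
  by apply: leT => //; [exact: nice_iterT|move=> y; have [] := IH y].
have c0 : (0 <= n%:R * (k * tail u))%R by rewrite !mulr_ge0.
have nc := nice_cst c0.
apply: (@le_trans _ _ (T (iter n A g \+ cst (n%:R * (k * tail u))%:E) x)).
  apply: leT; [exact: nice_iterT|exact: niceD|move=> y; have [] := IH y => //].
rewrite TD//= TAB//= Tcst// -addeA leeD2l// -natr1 mulrDl mul1r EFinD addeC leeD2l//.
by apply: Bk => // y; exact: iterAk.
Qed.

(** [n] jumps of size at most [u] cannot carry the walk from [x] beyond [x + n u]. *)
Lemma eq_iter_shift_trunc n f g x : (forall y, (y <= x + n%:R * u)%R -> f y = g y) ->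
  iter n A f x = iter n A g x.
Proof.
elim: n x => [|n IH] x fg; first by apply: fg; rewrite mul0r addr0.
rewrite !iterS; apply: eq_integral => y _.
have [yu|uy] := leP y u; last by rewrite /wA /= indicE mem_setE in_itv/= leNgt uy/= !mul0e.
rewrite IH// => z zy; apply: fg; apply: (le_trans zy); rewrite -natr1 mulrDl mul1r.
by rewrite -!addrA lerD2l addrC lerD2l.
Qed.

End Truncation.


Hypothesis mtail : measurable_fun setT tail.

(* Probability that one more summand brings the walk from [y] above [t], cut off at [d t]. *)
Definition jump_kernel (d t y : R) : R := if (y <= d * t)%R then tail (t - y) else 0%R.

Lemma measurable_jump_kernel d t : measurable_fun setT (jump_kernel d t).
Proof.
apply: measurable_fun_ifT => //.
- by apply: measurable_fun_ler.
- by apply: measurableT_comp => //; exact: measurable_funB.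
Qed.

Lemma jump_kernel_ge0 d t y : (0 <= jump_kernel d t y)%R.
Proof. by rewrite /jump_kernel; case: ifP; rewrite ?tail_ge0. Qed.

Lemma jump_kernel_le d t y x : (x <= (1 - d) * t)%R -> (jump_kernel d t y <= tail x)%R.
Proof.
rewrite /jump_kernel => xt; case: ifP => [yd|_]; rewrite ?tail_ge0//.
by apply: tail_nonincr; lra.
Qed.

(** The upper estimate costs [n.+1 ^+ 2] two-jump terms. In the lower one, passing from truncated
    steps to full steps in the kernel costs [n.+1 * n] of them. Hence a common error. *)
Lemma one_big_jump (n : nat) (d t u : R) : (0 < t)%R -> (0 < d <= 1 / 2)%R ->
  u = (d * t / n.+1%:R)%R ->
  (`|fine (sum_law mu n.+1 `]t, +oo[%classic)
    - n.+1%:R * fine (\int[sum_law mu n]_y (jump_kernel d t y)%:E)| <=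
  n.+1%:R ^+ 2 * tail u ^+ 2)%R.
Proof.
move=> t0 /andP[d0 d1] uE.
have n0 : (0 < n.+1%:R :> R)%R by [].
have nu : (n.+1%:R * u = d * t)%R by rewrite uE mulrC divfK ?gt_eqF.
have u0 : (0 < u)%R by rewrite uE divr_gt0// mulr_gt0.
have udt : (u <= d * t)%R by rewrite -nu ler_peMl ?ler1n// ltW.
have dt : (d * t <= t / 2)%R by nra.
pose f : R -> \bar R := EFin \o \1_(`]t, +oo[%classic).
pose g : R -> \bar R := fun y => (jump_kernel d t y)%:E.
have mf : measurable_fun setT f by exact/measurable_EFinP.
have f0 x : 0 <= f x by rewrite lee_fin.
have f1 x : f x <= 1 by rewrite lee_fin indicE; case: (_ \in _).
have mg : measurable_fun setT g by apply/measurable_EFinP; exact: measurable_jump_kernel.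
have g0 x : 0 <= g x by rewrite lee_fin jump_kernel_ge0.
have gk x : g x <= (tail u)%:E by rewrite lee_fin; apply: jump_kernel_le; lra.
have HE : sum_law mu n.+1 `]t, +oo[%classic = iter n.+1 (shift_int mu (cst 1)) f 0%R.
  rewrite iter_shift_int_law//; under eq_integral do rewrite add0r.
  by rewrite integral_indic// setIT.
have GE : \int[sum_law mu n]_y (jump_kernel d t y)%:E = iter n (shift_int mu (cst 1)) g 0%R.
  by rewrite iter_shift_int_law//; under [RHS]eq_integral do rewrite add0r.
have := iter_shift_two_jumps u n 0 mf f0 f1.
have := iter_shift_one_jump u n 0 (tail_ge0 u) mg g0 gk.
rewrite -HE -GE.
set A := shift_int mu _; set B := shift_int mu _ f.
(* [n.+1] small jumps sum to at most [d t], which is below [t]. *)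
have Af0 : iter n.+1 A f 0%R = 0.
  rewrite (@eq_iter_shift_trunc u n.+1 f (cst 0)).
    elim: n.+1 (0%R : R) => [//|k IH] x; rewrite iterS /A /shift_int.
    by under eq_integral do rewrite IH mule0; rewrite integral0.
  move=> y; rewrite add0r nu => yd; rewrite /f /= indicE mem_setE in_itv/= andbT.
  by rewrite ltNge (le_trans yd)//; lra.
(* After [n] small jumps the walk is at most [d t]. Crossing [t] from there takes a jump above
   [t / 2 >= u], so the restriction to large jumps is automatic and [B] agrees with the kernel. *)
have -> : iter n A B 0%R = iter n A g 0%R.
  apply: eq_iter_shift_trunc => y; rewrite add0r => yd.
  have {}yd : (y <= d * t)%R.
    by apply: (le_trans yd); rewrite -nu ler_pM2r// ler_nat.
  rewrite /g /jump_kernel yd tailE /B /shift_int -[X in mu X]setIT -integral_indic//.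
  apply: eq_integral => z _; rewrite /f /= -EFinM !indicE !mem_setE !in_itv/= !andbT.
  rewrite ltrBlDl; have [yz|] := ltP t (y + z)%R; last by rewrite mulr0.
  by rewrite (_ : u < z)%R ?mul1r//; lra.
rewrite Af0 add0e.
have finN : iter n A g 0%R \is a fin_num.
  rewrite ge0_fin_numE; last first.
    have Ag0 k x : 0 <= iter k A g x.
      elim: k x => [//|k IH] x.
      by rewrite iterS; apply: shift_int_ge0 => // y; rewrite lee_fin.
    exact: Ag0.
  apply: (@le_lt_trans _ _ (\int[sum_law mu n]_y (jump_kernel d t y)%:E)).
    by have [] := iter_shift_one_jump u n 0 (tail_ge0 u) mg g0 gk; rewrite -GE.
  apply: (@le_lt_trans _ _ (\int[sum_law mu n]_y (cst (tail u)%:E) y)).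
    by apply: (ge0_le_integral _ measurableT) => //; move=> y _; [exact: g0|exact: gk].
  by rewrite integral_cst// [X in _ * X]probability_setT mule1 ltry.
have finH : sum_law mu n.+1 `]t, +oo[%classic \is a fin_num by exact: fin_num_measure.
move: finN finH; set N := iter n A g 0%R; set H := sum_law mu n.+1 _; set G := \int[_]_y _.
move: N H G => [N| |]// [H| |]// [G| |]//= _ _; last by move=> [].
  rewrite -!EFinM -!EFinD !lee_fin => -[h1 h2] [h3 h4].
  move: h1 h2 h3 h4; rewrite -(natr1 n); set k := (n%:R : R); set v := tail u.
  have k0 : (0 <= k)%R by []; have v0 : (0 <= v)%R by exact: tail_ge0.
  by move=> h1 h2 h3 h4; rewrite ler_norml; apply/andP; split; nra.
by move=> [].
Qed.

(** Takes over from [one_big_jump] when [n] is so large compared with [t] that the quadratic error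
    is worse than trivial. *)
Lemma one_big_jump_crude (n : nat) (d t x : R) : (x <= (1 - d) * t)%R ->
  (`|fine (sum_law mu n.+1 `]t, +oo[%classic)
    - n.+1%:R * fine (\int[sum_law mu n]_y (jump_kernel d t y)%:E)| <=
  1 + n.+1%:R * tail x)%R.
Proof.
move=> xt.
have h1 : (0 <= fine (sum_law mu n.+1 `]t, +oo[%classic) <= 1)%R.
  apply/andP; split; first exact: fine_ge0.
  by rewrite -lee_fin fineK ?fin_num_measure//; apply: probability_le1.
have h2 : (0 <= fine (\int[sum_law mu n]_y (jump_kernel d t y)%:E) <= tail x)%R.
  have G0 : 0 <= \int[sum_law mu n]_y (jump_kernel d t y)%:E.
    by apply: integral_ge0 => y _; rewrite lee_fin jump_kernel_ge0.
  have G1 : \int[sum_law mu n]_y (jump_kernel d t y)%:E <= (tail x)%:E.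
    apply: (@le_trans _ _ (\int[sum_law mu n]_y (cst (tail x)%:E) y)).
      apply: ge0_le_integral => //.
      - by move=> y _; rewrite lee_fin jump_kernel_ge0.
      - by apply/measurable_EFinP; exact: measurable_jump_kernel.
      - by move=> y _; rewrite lee_fin jump_kernel_le.
    by rewrite integral_cst// [X in _ * X]probability_setT mule1.
  by rewrite fine_ge0//= -lee_fin fineK// ge0_fin_numE// (le_lt_trans G1)// ltry.
have n0 : (0 <= n.+1%:R :> R)%R by [].
move/andP: h1 => [h1 h1']; move/andP: h2 => [h2 h2']; rewrite ler_norml.
by apply/andP; split; nra.
Qed.

End BigJump.

(** * Absolute moments of the partial sums *)

Section Moments.
Variable R : realType.

(** In the induction the defect is [a b (x - y) (x^m - y^m)], a product of two differences of the
    same sign. *)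
Lemma convex_expr (a b x y : R) (m : nat) : 0 <= a -> 0 <= b -> a + b = 1 -> 0 <= x -> 0 <= y ->
  (a * x + b * y) ^+ m <= a * x ^+ m + b * y ^+ m.
Proof.
move=> a0 b0 ab x0 y0; elim: m => [|m IH]; first by rewrite !expr0 !mulr1 ab.
rewrite exprS; apply: (@le_trans _ _ ((a * x + b * y) * (a * x ^+ m + b * y ^+ m))).
  by rewrite ler_wpM2l// addr_ge0// mulr_ge0.
rewrite -subr_ge0 !exprS.
have -> : a * (x * x ^+ m) + b * (y * y ^+ m) - (a * x + b * y) * (a * x ^+ m + b * y ^+ m)
    = (a * b) * ((x - y) * (x ^+ m - y ^+ m)).
  have -> : b = 1 - a by lra.
  ring.
apply: mulr_ge0; first exact: mulr_ge0.
have [xy|/ltW xy] := leP x y.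
  by rewrite -mulrNN !opprB mulr_ge0 ?subr_ge0 ?lerXn2r.
by rewrite mulr_ge0 ?subr_ge0 ?lerXn2r.
Qed.

(** Convexity with weights [1 / (n + 2)] and [(n + 1) / (n + 2)], the shares of one summand and of
    the other [n + 1]. With them the induction on moments closes with the exact factor [n^m], where
    equal weights would give exponential growth. *)
Lemma exprD_le_weighted (n m : nat) (x y : R) : 0 <= x -> 0 <= y ->
  (x + y) ^+ m <= n.+2%:R ^+ m / n.+2%:R * x ^+ m
    + (n.+2%:R / n.+1%:R) ^+ m * (n.+1%:R / n.+2%:R) * y ^+ m.
Proof.
move=> x0 y0; have n1 : n.+1%:R != 0 :> R by rewrite pnatr_eq0.
have n2 : n.+2%:R != 0 :> R by rewrite pnatr_eq0.
have := @convex_expr (n.+2%:R^-1) (n.+1%:R / n.+2%:R) (n.+2%:R * x) (n.+2%:R / n.+1%:R * y) m.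
have -> : n.+2%:R^-1 * (n.+2%:R * x) + n.+1%:R / n.+2%:R * (n.+2%:R / n.+1%:R * y) = x + y.
  by rewrite mulKf//; congr (_ + _); move: n1 n2; move: (n.+1%:R : R) (n.+2%:R : R) => p q p0 q0; field; rewrite q0 p0.
move=> h; apply: (le_trans (h _ _ _ _ _)); rewrite ?divr_ge0 ?invr_ge0 ?mulr_ge0 ?divr_ge0//.
  by rewrite -(natr1 n.+1) -[X in X + _]mul1r -mulrDl addrC natr1 divff// natr1.
by rewrite !exprMn le_eqVlt; apply/orP; left; apply/eqP; ring.
Qed.

Lemma exprD_le_half (m : nat) (x y : R) : 0 <= x -> 0 <= y ->
  (x + y) ^+ m <= 2 ^+ m * (x ^+ m + y ^+ m).
Proof.
move=> x0 y0.
have -> : x + y = 2 * (1 / 2 * x + 1 / 2 * y) by field.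
rewrite exprMn ler_pM2l ?exprn_gt0//.
apply: (le_trans (convex_expr m _ _ _ x0 y0)); [lra|lra|lra|].
have := exprn_ge0 m x0; have := exprn_ge0 m y0; lra.
Qed.

Lemma expr_le1D (j m : nat) (x : R) : 0 <= x -> (j <= m)%N -> x ^+ j <= 1 + x ^+ m.
Proof.
move=> x0 jm; have [x1|x1] := leP x 1.
  by apply: (@le_trans _ _ 1); [exact: exprn_ile1|rewrite lerDl exprn_ge0].
by apply: (@le_trans _ _ (x ^+ m)); [rewrite ler_weXn2l// ltW|rewrite lerDr].
Qed.

Lemma integral_prob_cst (P : probability R R) (r : R) : (\int[P]_y r%:E = r%:E)%E.
Proof. by rewrite integral_cst// [X in (_ * X)%E]probability_setT mule1. Qed.

Variable mu : probability R R.
Hypothesis mu0 : mu `]-oo, 0[%classic = 0%E.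
Local Open Scope ereal_scope.

(** A negative sum has a negative summand, so the indicator of the negative half-line is
    subadditive. *)
Lemma sum_law_neg n : sum_law mu n `]-oo, (0%R : R)[%classic = 0.
Proof.
have ind_ge0 (A : set R) x : 0 <= (\1_A x : R)%:E by rewrite lee_fin.
have mind (A : set R) : measurable A -> measurable_fun setT (fun x : R => (\1_A x : R)%:E).
  by move=> mA; apply/measurable_EFinP.
elim: n => [|n IH].
  by rewrite /= diracE mem_setE in_itv/= ltxx.
apply/eqP; rewrite eq_le measure_ge0 andbT.
rewrite -[X in sum_law mu n.+1 X]setIT -integral_indic// ge0_integral_sum_lawS//; last exact: mind.
pose f (x : R) := (\1_(`]-oo, (0%R : R)[%classic) x : R)%:E.
apply: (@le_trans _ _ (\int[mu]_x (f x + sum_law mu n `]-oo, (0%R : R)[%classic))).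
  apply: ge0_le_integral => //.
  - by move=> x _; apply: integral_ge0 => y _.
  - apply: (measurable_fun_fubini_tonelli_F (fun z : R * R => f (z.1 + z.2)%R)).
      by apply: measurableT_comp; [exact: mind|exact: measurable_funD].
    by move=> z; exact: ind_ge0.
  - by apply: emeasurable_funD => //; exact: mind.
  - move=> x _; rewrite -[X in _ + X](_ : \int[sum_law mu n]_y f y = _); last first.
      by rewrite integral_indic// setIT.
    rewrite -[X in X + _](_ : \int[sum_law mu n]_y (cst (f x)) y = _); last first.
      by rewrite integral_cst// [X in _ * X]probability_setT mule1.
    rewrite -ge0_integralD; [|exact: measurableT|by move=> y _; exact: ind_ge0|by []|by move=> y _; exact: ind_ge0|exact: mind].
    apply: ge0_le_integral; [exact: measurableT|by move=> y _; exact: ind_ge0|..].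
    + exact: (measurable_shift x (mind _ _)).
    + by apply: emeasurable_funD => //; exact: mind.
    + move=> y _; rewrite /f -EFinD lee_fin !indicE !mem_setE !in_itv/=.
      have [x0|x0] := ltP x 0%R; have [y0|y0] := ltP y 0%R; case: ltP => //=; try lra.
rewrite IH ge0_integralD; [|exact: measurableT|by move=> x _; exact: ind_ge0|exact: mind|by []|by []].
have -> : \int[mu]_x f x = 0 by rewrite integral_indic// setIT.
by rewrite integral0 adde0.
Qed.

Lemma measurable_absX (m : nat) : measurable_fun setT (fun y : R => (`|y| ^+ m)%:E).
Proof. by apply/measurable_EFinP; apply: measurable_funX; exact: normr_measurable. Qed.

Lemma absX_ge0 (m : nat) (y : R) : 0 <= (`|y| ^+ m)%:E.
Proof. by rewrite lee_fin exprn_ge0. Qed.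

(** Same growth as Minkowski's inequality gives. Growth polynomial in [n] is what allows a power
    moment of [N] to dominate the sum. *)
Lemma sum_law_moment_le (m : nat) (M : R) : (1 <= M)%R ->
  \int[mu]_y (`|y| ^+ m)%:E <= M%:E -> forall n : nat,
  \int[sum_law mu n]_y (`|y| ^+ m)%:E <= (n%:R ^+ m * M)%:E.
Proof.
move=> M1 hM; have mX := measurable_absX m; have X0 := @absX_ge0 m.
case=> [|n].
  (* For [m = 0] both powers of 0 equal 1, and [1 <= M] is used. *)
  by rewrite integral_sum_law0// normr0 lee_fin !expr0n ler_peMr.
elim: n => [|n IH].
  rewrite ge0_integral_sum_lawS// expr1n mul1r; apply: le_trans hM.
  apply: ge0_le_integral => //.
  - by move=> x _; apply: integral_ge0 => y _.
  - apply: (measurable_fun_fubini_tonelli_F (fun z : R * R => (`|z.1 + z.2| ^+ m)%:E)) => //.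
    by apply: (measurableT_comp mX); exact: measurable_funD.
  - move=> x _; rewrite integral_sum_law0 ?addr0//.
    exact: (measurable_shift x mX).
pose a : R := (n.+2%:R ^+ m / n.+2%:R)%R.
pose b : R := ((n.+2%:R / n.+1%:R) ^+ m * (n.+1%:R / n.+2%:R))%R.
have a0 : (0 <= a)%R by rewrite /a divr_ge0// exprn_ge0.
have b0 : (0 <= b)%R by rewrite /b mulr_ge0 ?exprn_ge0 ?divr_ge0.
have mZ (c : R) : measurable_fun setT (fun y : R => c%:E * (`|y| ^+ m)%:E).
  by apply: emeasurable_funM.
have Z0 (c y : R) : (0 <= c)%R -> 0 <= c%:E * (`|y| ^+ m)%:E.
  by move=> c0; apply: mule_ge0; [rewrite lee_fin|exact: X0].
rewrite ge0_integral_sum_lawS//.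
apply: (@le_trans _ _ (\int[mu]_x (a%:E * (`|x| ^+ m)%:E + (b * (n.+1%:R ^+ m * M))%:E))).
  apply: ge0_le_integral => //.
  - by move=> x _; apply: integral_ge0 => y _.
  - apply: (measurable_fun_fubini_tonelli_F (fun z : R * R => (`|z.1 + z.2| ^+ m)%:E)) => //.
    by apply: (measurableT_comp mX); exact: measurable_funD.
  - exact: emeasurable_funD.
  - move=> x _.
    apply: (@le_trans _ _ (\int[sum_law mu n.+1]_y (a%:E * (`|x| ^+ m)%:E + b%:E * (`|y| ^+ m)%:E))).
      apply: ge0_le_integral => //.
      + exact: (measurable_shift x mX).
      + by apply: emeasurable_funD.
      + move=> y _; rewrite -!EFinM -EFinD lee_fin.
        apply: le_trans (exprD_le_weighted n m (normr_ge0 x) (normr_ge0 y)).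
        by rewrite lerXn2r ?nnegrE ?addr_ge0 ?ler_normD.
    rewrite ge0_integralD//; [|by move=> y _; exact: Z0..].
    rewrite -EFinM integral_prob_cst leeD2l//.
    rewrite ge0_integralZl// [leRHS]EFinM; apply: lee_pmul => //.
    by apply: integral_ge0 => y _.
rewrite ge0_integralD//; [|by move=> y _; exact: Z0|by move=> y _; rewrite lee_fin !mulr_ge0// ?exprn_ge0// (le_trans ler01)].
rewrite integral_prob_cst ge0_integralZl//.
apply: (@le_trans _ _ (a%:E * M%:E + (b * (n.+1%:R ^+ m * M))%:E)).
  rewrite leeD2r//; apply: lee_pmul => //; by apply: integral_ge0 => y _.
rewrite -EFinM -EFinD lee_fin /a /b.
have n1 : (n.+1%:R != 0 :> R)%R by rewrite pnatr_eq0.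
have n2 : (n.+2%:R != 0 :> R)%R by rewrite pnatr_eq0.
rewrite le_eqVlt; apply/orP; left; apply/eqP.
transitivity (n.+2%:R ^+ m * M * ((1 + n.+1%:R) / n.+2%:R))%R.
  rewrite expr_div_n; have : (n.+1%:R ^+ m != 0 :> R)%R by rewrite expf_neq0.
  move: (n.+2%:R ^+ m)%R (n.+1%:R ^+ m)%R => p q q0.
  by move: n2; move: (n.+2%:R : R) => r r0; field; rewrite r0 q0.
by rewrite addrC natr1 divff// mulr1.
Qed.


(** If [2^(k+1)] is the first power of 2 that reaches [y > 1], then [y > 2^k], and the term of index
    [k] alone dominates [y^m]. *)
Lemma dyadic_majorant (m : nat) (y : R) : (0 <= y)%R ->
  (`|y| ^+ m)%:E <= 1 + \sum_(0 <= k <oo)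
     (((2 ^+ m) ^+ k.+1 : R)%:E * (\1_(`](2 ^+ k : R), +oo[%classic) y)%:E).
Proof.
move=> y0; rewrite ger0_norm//.
have term0 k : 0 <= ((2 ^+ m) ^+ k.+1 : R)%:E * (\1_(`](2 ^+ k : R), +oo[%classic) y)%:E.
  by rewrite mule_ge0// lee_fin// !exprn_ge0.
have [y1|y1] := leP y 1%R.
  rewrite -[leLHS]adde0 leeD//; first by rewrite lee_fin exprn_ile1.
  by apply: nneseries_ge0 => k _ _; exact: term0.
have ex : exists n, (y <= 2 ^+ n)%R.
  exists (Num.truncn y).+1; apply: (le_trans (ltW (truncnS_gt y))).
  by rewrite -natrX ler_nat ltnW// ltn_expl.
case: (ex_minnP ex) => -[|k] yk kmin; first by move: yk; rewrite expr0 leNgt y1.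
have yk' : (2 ^+ k < y)%R.
  by rewrite ltNge; apply/negP => /kmin; rewrite ltnn.
apply: (@le_trans _ _ ((2 ^+ m) ^+ k.+1)%:E).
  by rewrite lee_fin exprAC lerXn2r ?nnegrE// exprn_ge0.
rewrite -[leLHS]add0e leeD//.
apply: (@le_trans _ _ (((2 ^+ m) ^+ k.+1 : R)%:E * (\1_(`](2 ^+ k : R), +oo[%classic) y)%:E)).
  by rewrite indicE mem_setE in_itv/= yk' mule1.
apply: le_trans (nneseries_lim_ge k.+1 _); last by move=> i _ _; exact: term0.
rewrite big_mkord big_ord_recr/= leeDr//; apply: sume_ge0 => i _; exact: term0.
Qed.

(** Integrating the dyadic majorant turns the moment into a series of tails at [2^k], dominated by a
    geometric series of ratio [2^(m - beta) < 1]. *)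
Lemma moment_lty (m : nat) (C beta : R) : (0 < C)%R -> (m%:R < beta)%R ->
  (forall x, 0 < x -> tail mu x <= C * x `^ (- beta))%R ->
  \int[mu]_y (`|y| ^+ m)%:E < +oo.
Proof.
move=> C0 mb tb; have mX := measurable_absX m; have X0 := @absX_ge0 m.
pose F k (y : R) : \bar R := ((2 ^+ m) ^+ k.+1 : R)%:E * (\1_(`](2 ^+ k : R), +oo[%classic) y)%:E.
have F0 k y : 0 <= F k y by rewrite /F mule_ge0// lee_fin// !exprn_ge0.
have mF k : measurable_fun setT (F k).
  by apply: emeasurable_funM => //; exact/measurable_EFinP.
have mS : measurable_fun setT (fun y => 1 + \sum_(0 <= k <oo) F k y).
  apply: emeasurable_funD => //; apply: ge0_emeasurable_sum => //.
have S0 y : 0 <= 1 + \sum_(0 <= k <oo) F k y.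
  by rewrite adde_ge0//; apply: nneseries_ge0 => k _ _; exact: F0.
have mN : measurable `]-oo, (0%R : R)[%classic by [].
apply: (@le_lt_trans _ _ (\int[mu]_y (1 + \sum_(0 <= k <oo) F k y))).
  rewrite (ge0_negligible_integral mN measurableT mX (fun x _ => X0 x) mu0).
  apply: (@le_trans _ _ (\int[mu]_(y in setT `\` `]-oo, (0%R : R)[%classic) (1 + \sum_(0 <= k <oo) F k y))).
    apply: ge0_le_integral => //.
    - exact: measurableD.
    - exact: measurable_funTS.
    - exact: measurable_funTS.
    - move=> y [_ /=]; rewrite in_itv/= => /negP; rewrite -leNgt => y0.
      exact: dyadic_majorant.
  by apply: ge0_subset_integral => //; exact: measurableD.
rewrite ge0_integralD//; last 2 first.
  by move=> y _; apply: nneseries_ge0 => k _ _; exact: F0.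
  by apply: ge0_emeasurable_sum.
rewrite integral_cst// [X in _ * X + _]probability_setT mule1.
rewrite integral_nneseries//.
pose r : R := (2 ^+ m * 2 `^ (- beta))%R.
have r0 : (0 < r)%R by rewrite mulr_gt0 ?exprn_gt0// powR_gt0.
have r1 : (r < 1)%R.
  rewrite /r -powR_mulrn// -powRD ?pnatr_eq0 ?implybT//.
  rewrite -[ltRHS](powRr0 (2 : R)) /powR pnatr_eq0/= ltr_expR ltr_pM2r.
    by rewrite subr_lt0.
  by rewrite ln_gt0// ltr1n.
apply: (@le_lt_trans _ _ (1 + (2 ^+ m * C / (1 - r))%:E)); last by rewrite -EFinD ltry.
rewrite leeD2l//; apply: lime_le.
  by apply: is_cvg_nneseries => k _ _; apply: integral_ge0 => y _; exact: F0.
apply: nearW => n.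
apply: (@le_trans _ _ (series (geometric (2 ^+ m * C) r) n)%:E); last first.
  rewrite lee_fin; apply: geometric_le_lim => //; last by rewrite gtr0_norm.
  by rewrite mulr_ge0 ?exprn_ge0// ltW.
rewrite /series/= -sumEFin; apply: lee_sum => k _.
rewrite /F ge0_integralZl; [|exact: measurableT|exact/measurable_EFinP|by move=> y _; rewrite lee_fin|by rewrite lee_fin !exprn_ge0].
have -> : \int[mu]_x (\1_(`](2 ^+ k : R), +oo[%classic) x)%:E = (tail mu (2 ^+ k))%:E.
  by rewrite tailE integral_indic// setIT.
rewrite -EFinM lee_fin.
  have k2 : (0 < 2 ^+ k :> R)%R by rewrite exprn_gt0.
  apply: (@le_trans _ _ ((2 ^+ m) ^+ k.+1 * (C * (2 ^+ k) `^ (- beta)))%R).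
    by rewrite ler_wpM2l ?tb// !exprn_ge0.
  have -> : ((2 ^+ k) `^ (- beta) = (2 `^ (- beta)) ^+ k :> R)%R.
    by rewrite -powR_mulrn// -powRrM mulrC powRrM powR_mulrn// powR_ge0.
  by rewrite /r exprMn exprS le_eqVlt; apply/orP; left; apply/eqP; ring.
Qed.

End Moments.

(** * Integrals of monomials and of the Taylor remainder *)

Section SignedMoments.
Variable R : realType.
Variable mu : probability R R.
Hypothesis mu0 : mu `]-oo, 0[%classic = 0%E.
Variables (m : nat) (M : R).
Hypothesis M1 : 1 <= M.
Hypothesis hM : (\int[mu]_y (`|y| ^+ m)%:E <= M%:E)%E.
Local Open Scope ereal_scope.

Lemma integrable_absX n : (sum_law mu n).-integrable setT (fun y => (`|y| ^+ m)%:E).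
Proof.
apply/integrableP; split; first exact: measurable_absX.
under eq_integral do rewrite gee0_abs ?absX_ge0//.
by rewrite (le_lt_trans (sum_law_moment_le M1 hM n))// ltry.
Qed.

Lemma measurable_shiftX (z : R) j : measurable_fun setT (fun y : R => ((z + y) ^+ j)%:E).
Proof. by apply/measurable_EFinP; apply: measurable_funX; exact: measurable_funD. Qed.

Lemma integrable_shiftX n j (z : R) : (j <= m)%N ->
  (sum_law mu n).-integrable setT (fun y => ((z + y) ^+ j)%:E).
Proof.
move=> jm; pose K : R := (1 + 2 ^+ m * `|z| ^+ m)%R.
have ig : (sum_law mu n).-integrable setT (fun y => K%:E + (2 ^+ m)%:E * (`|y| ^+ m)%:E).
  apply: integrableD => //; first exact: finite_measure_integrable_cst.
  by apply: integrableZl => //; exact: integrable_absX.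
apply: le_integrable ig => //; first exact: measurable_shiftX.
move=> y _; rewrite -EFinM -EFinD !abse_EFin lee_fin normrX.
rewrite [leRHS]ger0_norm; last by rewrite addr_ge0 ?addr_ge0 ?mulr_ge0 ?exprn_ge0.
apply: (le_trans (expr_le1D (normr_ge0 _) jm)); rewrite /K -addrA lerD2l -mulrDr.
apply: le_trans (exprD_le_half m (normr_ge0 z) (normr_ge0 y)).
by rewrite lerXn2r ?nnegrE ?addr_ge0 ?ler_normD.
Qed.

(** Monomials may change sign, so Tonelli is replaced by Fubini; integrability on the product is
    read off from the law of [n + 1] summands. *)
Lemma conv_int_monomial n j (z : R) : (j <= m)%N ->
  conv_int mu n (fun y => (z + y) ^+ j)%R = \int[sum_law mu n]_y ((z + y) ^+ j)%:E.
Proof.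
move=> jm; elim: n z => [|n IH] z.
  by rewrite integral_sum_law0//; exact: measurable_shiftX.
rewrite [LHS]/=; transitivity (\int[mu]_x \int[sum_law mu n]_y ((z + x + y) ^+ j)%:E).
  apply: eq_integral => x _; rewrite -IH; congr conv_int.
  by apply/funext => y; rewrite addrA.
pose f (w : R) : \bar R := ((z + w) ^+ j)%:E.
have mf : measurable_fun setT f by exact: measurable_shiftX.
have mfs : measurable_fun setT (f \o @sum_pair R).
  by apply: measurableT_comp => //; exact: measurable_sum_pair.
have ifs : (mu \x sum_law mu n).-integrable setT (f \o @sum_pair R).
  apply/integrable12ltyP => //.
  have /integrableP[_] := integrable_shiftX n.+1 z jm.
  rewrite (@ge0_integral_sum_lawS _ _ _ (fun w => `|f w|))//.
  exact: measurableT_comp.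
rewrite /= integral_distribution// -integral12_prod_meas1//.
by apply: eq_integral => x _; apply: eq_integral => y _; rewrite /= /f /sum_pair/= addrA.
Qed.

Definition sum_moment n j : R := fine (\int[sum_law mu n]_y (y ^+ j)%:E).

Lemma integrable_X n j : (j <= m)%N -> (sum_law mu n).-integrable setT (fun y => (y ^+ j)%:E).
Proof. by move=> jm; have := integrable_shiftX n 0 jm; under eq_fun do rewrite add0r. Qed.

Lemma sum_momentE n j : (j <= m)%N -> \int[sum_law mu n]_y (y ^+ j)%:E = (sum_moment n j)%:E.
Proof. by move=> jm; rewrite fineK//; apply: integrable_fin_num => //; exact: integrable_X. Qed.

Lemma momentE n j : (j <= m)%N -> moment mu n j = (sum_moment n j)%:E.
Proof.
move=> jm; rewrite -sum_momentE// /moment.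
have := conv_int_monomial n 0 jm; under eq_fun do rewrite add0r.
by move=> ->; apply: eq_integral => y _; rewrite add0r.
Qed.

Lemma sum_moment_bound n j : (j <= m)%N -> (`|sum_moment n j| <= 1 + n%:R ^+ m * M)%R.
Proof.
move=> jm; rewrite -lee_fin -abse_EFin -sum_momentE//.
have iX := integrable_X n jm; have mX := measurable_int _ iX.
apply: (le_trans (le_abse_integral _ measurableT mX)).
apply: (@le_trans _ _ (\int[sum_law mu n]_y (1 + (`|y| ^+ m)%:E))).
  apply: ge0_le_integral => //.
  - exact: measurableT_comp.
  - by apply: emeasurable_funD => //; exact: measurable_absX.
  - by move=> y _; rewrite abse_EFin -EFinD lee_fin normrX expr_le1D.
rewrite ge0_integralD; [|exact: measurableT|by []|by []|by move=> y _; exact: absX_ge0|exact: measurable_absX].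
rewrite integral_prob_cst EFinD leeD2l//.
exact: sum_law_moment_le.
Qed.

Lemma sum_moment_ge0 n j : (j <= m)%N -> (0 <= sum_moment n j)%R.
Proof.
move=> jm; rewrite -lee_fin -sum_momentE//.
have iX := integrable_X n jm; have mX := measurable_int _ iX.
rewrite (negligible_integral (N := `]-oo, (0%R : R)[%classic) _ _ iX)//; last exact: sum_law_neg.
apply: integral_ge0 => y [_ /=]; rewrite in_itv/= => /negP; rewrite -leNgt => y0.
by rewrite lee_fin exprn_ge0.
Qed.

Lemma integrable_taylor n (a : nat -> R) :
  (sum_law mu n).-integrable setT (fun y => (taylor a m (- y))%:E).
Proof.
rewrite (_ : (fun y : R => _) = (fun y => \sum_(j < m.+1) ((-1) ^+ j / j`!%:R * a j)%:E * (y ^+ j)%:E)); last first.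
  apply/funext => y; rewrite /taylor -sumEFin; apply: eq_bigr => j _.
  rewrite -EFinM (exprNn y); congr EFin.
  by move: ((-1) ^+ j)%R (y ^+ j)%R => p q; ring.
apply: integrable_sum => // j _; apply: integrableZl => //.
by apply: integrable_X; rewrite -ltnS.
Qed.

Lemma integral_taylor n (a : nat -> R) :
  \int[sum_law mu n]_y (taylor a m (- y))%:E =
  (\sum_(j < m.+1) (-1) ^+ j / j`!%:R * a j * sum_moment n j)%:E.
Proof.
transitivity (\int[sum_law mu n]_y (\sum_(j < m.+1) ((-1) ^+ j / j`!%:R * a j)%:E * (y ^+ j)%:E)).
  apply: eq_integral => y _; rewrite /taylor -sumEFin; apply: eq_bigr => j _.
  rewrite -EFinM (exprNn y); congr EFin.
  by move: ((-1) ^+ j)%R (y ^+ j)%R => p q; ring.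
have iX (j : 'I_m.+1) : (sum_law mu n).-integrable setT (fun y => (y ^+ j)%:E).
  by apply: integrable_X; rewrite -ltnS.
rewrite integral_sum//; last by move=> j; exact: integrableZl.
rewrite -sumEFin; apply: eq_bigr => j _.
by rewrite integralZl// EFinM sum_momentE// -ltnS.
Qed.

Hypothesis mtail : measurable_fun setT (tail mu).

Lemma integrable_jump_kernel n d t :
  (sum_law mu n).-integrable setT (fun y => (jump_kernel mu d t y)%:E).
Proof.
apply: (@le_integrable _ _ _ _ _ measurableT _ (cst 1)).
- by apply/measurable_EFinP; exact: measurable_jump_kernel.
- move=> y _; rewrite abse_EFin /= normr1 lee_fin ger0_norm ?jump_kernel_ge0//.
  by rewrite /jump_kernel; case: ifP; rewrite ?tail_le1.
- exact: finite_measure_integrable_cst.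
Qed.

Lemma integrable_jump_rem n d t :
  (sum_law mu n).-integrable setT (fun y => (jump_rem (tail mu) m d t y)%:E).
Proof.
rewrite (_ : (fun y => _) = (fun y => (jump_kernel mu d t y)%:E)
   \- (fun y => (taylor (fun j => derive1n j (tail mu) t) m (- y))%:E)); last first.
  by apply/funext => y; rewrite /= -EFinB.
by apply: integrableB => //; [exact: integrable_jump_kernel|exact: integrable_taylor].
Qed.

Lemma integral_jump_rem n d t :
  (fine (\int[sum_law mu n]_y (jump_kernel mu d t y)%:E)
   - \sum_(j < m.+1) (-1) ^+ j / j`!%:R * derive1n j (tail mu) t * sum_moment n j
  = fine (\int[sum_law mu n]_y (jump_rem (tail mu) m d t y)%:E))%R.
Proof.
have ik := integrable_jump_kernel n d t.
have it := integrable_taylor n (fun j => derive1n j (tail mu) t).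
transitivity (fine (\int[sum_law mu n]_y (jump_kernel mu d t y)%:E -
   \int[sum_law mu n]_y (taylor (fun j => derive1n j (tail mu) t) m (- y))%:E)).
  rewrite integral_taylor; have := integrable_fin_num measurableT ik.
  by move: (\int[_]_y (jump_kernel _ _ _ _)%:E) => [z| |].
by congr fine; rewrite -integralB//; apply: eq_integral => y _; rewrite -EFinB.
Qed.

Lemma ae_sum_law_ge0 n (P : R -> Prop) : (forall y, (0 <= y)%R -> P y) ->
  {ae sum_law mu n, forall y, P y}.
Proof.
move=> hP; exists `]-oo, (0%R : R)[%classic; split => //; first exact: sum_law_neg.
by move=> y /= nP; rewrite in_itv/= ltNge; apply/negP => /hP.
Qed.

Lemma integral_jump_rem_bound n d t (K : R) : (0 <= K)%R ->
  (forall y, 0 <= y -> `|jump_rem (tail mu) m d t y| <= K * y ^+ m)%R ->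
  (`|fine (\int[sum_law mu n]_y (jump_rem (tail mu) m d t y)%:E)| <= K * (n%:R ^+ m * M))%R.
Proof.
move=> K0 hK; have ij := integrable_jump_rem n d t.
have mj := measurable_int _ ij.
rewrite -lee_fin -abse_EFin fineK; last exact: integrable_fin_num.
apply: (le_trans (le_abse_integral _ measurableT mj)).
apply: (@le_trans _ _ (\int[sum_law mu n]_y (K%:E * (`|y| ^+ m)%:E))).
  apply: ae_ge0_le_integral => //.
  - exact: measurableT_comp.
  - by move=> y _; apply: mule_ge0; [rewrite lee_fin|exact: absX_ge0].
  - by apply: emeasurable_funM => //; exact: measurable_absX.
  - apply: ae_sum_law_ge0 => y y0 _.
    by rewrite abse_EFin -EFinM lee_fin (ger0_norm y0) hK.
rewrite ge0_integralZl; [|exact: measurableT|exact: measurable_absX|by move=> y _; exact: absX_ge0|by rewrite lee_fin].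
rewrite EFinM lee_pmul//; last exact: sum_law_moment_le.
by apply: integral_ge0 => y _; exact: absX_ge0.
Qed.

(** A failure for arbitrarily large [t] yields a sequence [u k] tending to infinity. Along it the
    remainder divided by [D] tends to 0 pointwise and is dominated by [C |y|^m], so dominated
    convergence gives a contradiction. *)
Lemma integral_jump_rem_littleo n d (C T : R) (D : R -> R) : (0 < C)%R ->
  (forall t, T < t -> 0 < D t)%R ->
  (forall t y, T < t -> 0 <= y -> `|jump_rem (tail mu) m d t y| <= C * y ^+ m * D t)%R ->
  (forall y eps, 0 <= y -> 0 < eps -> exists T' : R, forall t, T' < t ->
     `|jump_rem (tail mu) m d t y| <= eps * D t)%R ->
  forall eps : R, (0 < eps)%R -> exists T' : R, forall t, (T' < t)%R ->
    (`|fine (\int[sum_law mu n]_y (jump_rem (tail mu) m d t y)%:E)| <= eps * D t)%R.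
Proof.
move=> C0 D0 hC hl eps e0; apply: contrapT => /forallNP hT.
have /choice[u hu] : forall k : nat, exists t, (Num.max T k%:R < t)%R /\
    (eps * D t < `|fine (\int[sum_law mu n]_y (jump_rem (tail mu) m d t y)%:E)|)%R.
  move=> k; have /existsNP[t /not_implyP[Tt h]] := hT (Num.max T k%:R).
  by exists t; split => //; rewrite ltNge; exact/negP.
have uT k : (T < u k)%R by have [+ _] := hu k; rewrite gt_max => /andP[].
have uk k : (k%:R < u k)%R by have [+ _] := hu k; rewrite gt_max => /andP[].
pose f_ k (y : R) : \bar R := ((D (u k))^-1)%:E * (jump_rem (tail mu) m d (u k) y)%:E.
have if_ k : (sum_law mu n).-integrable setT (f_ k).
  by apply: integrableZl => //; exact: integrable_jump_rem.
have fnorm k (y : R) : (0 <= y)%R -> `|f_ k y| = ((D (u k))^-1 * `|jump_rem (tail mu) m d (u k) y|)%:E.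
  move=> y0; rewrite /f_ -EFinM abse_EFin normrM ger0_norm// invr_ge0 ltW//; exact: D0.
have f_cvg : {ae sum_law mu n, forall y, setT y -> f_ x0 y @[x0 --> \oo] --> (cst 0 : R -> \bar R) y}.
  apply: ae_sum_law_ge0 => y y0 _; apply/cvg_abse0P.
  apply: (@cvg_trans _ (((D (u k))^-1 * `|jump_rem (tail mu) m d (u k) y|)%:E @[k --> \oo])).
    by apply: near_eq_cvg; apply: nearW => k; rewrite -fnorm.
  apply: cvg_EFin; first by apply: nearW.
  apply/cvgrPdist_le => e e_gt0; have [T' hT'] := hl y e y0 e_gt0.
  near=> k; rewrite /= sub0r normrN ger0_norm; last first.
    by rewrite mulr_ge0// invr_ge0 ltW//; exact: D0.
  rewrite mulrC ler_pdivrMr; last exact: D0.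
  apply: hT'; apply: lt_trans (uk k).
  by near: k; exact: nbhs_infty_gtr.
have f_dom : {ae sum_law mu n, forall y k, setT y -> `|f_ k y| <= C%:E * (`|y| ^+ m)%:E}.
  apply: ae_sum_law_ge0 => y y0 k _; rewrite fnorm// -EFinM lee_fin mulrC.
  rewrite ler_pdivrMr; last exact: D0.
  by rewrite (ger0_norm y0); exact: hC.
have [_ _] := dominated_convergence measurableT (fun k => measurable_int _ (if_ k))
   (measurable_cst _) f_cvg (integrableZl measurableT C (integrable_absX n)) f_dom.
rewrite integral0 => /fine_cvgP[_ /cvgrPdist_lt/(_ _ e0)[k _ /(_ k (leqnn _))]] /=.
rewrite sub0r normrN /f_ integralZl//; last exact: integrable_jump_rem.
have [_] := hu k.
have := integrable_fin_num measurableT (integrable_jump_rem n d (u k)).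
move: (\int[_]_y _) => [z| |]//= _; rewrite normrM ger0_norm; last first.
  by rewrite invr_ge0 ltW//; exact: D0.
by move=> h1; rewrite mulrC ltr_pdivrMr; [lra|exact: D0].
Unshelve. all: by end_near. Qed.

End SignedMoments.

(** * Dominated summation and the choice of exponents *)

Section Summation.
Variable R : realType.

(** The convergent majorant makes the end of the series small uniformly in [t]; the finitely many
    remaining terms are then small for large [t]. *)
Lemma tannery (u : R -> nat -> R) (D : R -> R) (v : nat -> R) (T : R) :
  (forall t, T < t -> 0 <= D t) -> (forall n, 0 <= v n) ->
  (forall t n, T < t -> `|u t n| <= v n * D t) -> cvgn (series v) ->
  (forall n (eps : R), 0 < eps -> exists T' : R, forall t, T' < t -> `|u t n| <= eps * D t) ->
  forall eps : R, 0 < eps -> exists T' : R, forall t, T' < t ->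
    `|limn (series (u t))| <= eps * D t.
Proof.
move=> D0 v0 uv vc ul eps e0.
have [N hN] : exists N, forall n, (N <= n)%N -> series v n - series v N <= eps / 2.
  have /cvgrPdist_le/(_ (eps / 4)) := vc; rewrite divr_gt0// => /(_ isT)[N _ hN].
  exists N => n Nn; have := hN n Nn; have := hN N (leqnn N) => /=.
  by rewrite !ler_norml => /andP[? ?] /andP[? ?]; lra.
(* Each of the [N] terms gets a share of [eps / 2]; dividing by [N.+1] covers [N = 0]. *)
have [T1 hT1] : exists T1 : R, forall t, T1 < t -> forall n, (n < N)%N ->
    `|u t n| <= eps / 2 / N.+1%:R * D t.
  elim: {1}N => [|k [T1 hT1]]; first by exists 0.
  have [T2 hT2] := ul k (eps / 2 / N.+1%:R) (divr_gt0 (divr_gt0 e0 (ltr0Sn _ 1)) (ltr0Sn _ N)).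
  exists (Num.max T1 T2) => t; rewrite gt_max => /andP[t1 t2] n.
  by rewrite ltnS leq_eqVlt => /predU1P[->|nk]; [exact: hT2|exact: hT1].
exists (Num.max T T1) => t; rewrite gt_max => /andP[Tt T1t].
have Dt := D0 _ Tt.
have vDc : cvgn (series (fun n => v n * D t)).
  rewrite (_ : series _ = (fun n => series v n * D t)); first exact: is_cvgMl.
  by apply/funext => n; rewrite /series/= mulr_suml.
have uc : cvgn (series (u t)).
  apply: normed_cvg; apply: series_le_cvg vDc => [n|n|n] /=.
  - exact: normr_ge0.
  - by apply: mulr_ge0.
  - exact: uv.
have sN : `|series (u t) N| <= eps / 2 * D t.
  rewrite /series/=; apply: (le_trans (ler_norm_sum _ _ _)).
  apply: (@le_trans _ _ (\sum_(0 <= n < N) (eps / 2 / N.+1%:R * D t))).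
    by rewrite !big_nat; apply: ler_sum => n /andP[_ nN]; exact: hT1.
  rewrite sumr_const_nat subn0 -[leLHS]mulr_natl mulrA ler_wpM2r//.
  have := divr_gt0 e0 (ltr0Sn R 1); move: (eps / 2) => E E0.
  by rewrite mulrA ler_pdivrMr// mulrC ler_pM2l// ler_nat.
have sn n : (N <= n)%N -> `|series (u t) n| <= eps * D t.
  move=> Nn; have -> : series (u t) n = series (u t) N + (series (u t) n - series (u t) N) by ring.
  apply: (le_trans (ler_normD _ _)).
  have -> : eps * D t = eps / 2 * D t + eps / 2 * D t by field.
  apply: lerD => //; rewrite sub_series_geq//.
  apply: (le_trans (ler_norm_sum _ _ _)).
  apply: (@le_trans _ _ (\sum_(N <= k < n) v k * D t)).
    by apply: ler_sum => k _; exact: uv.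
  by rewrite -mulr_suml -sub_series_geq// ler_wpM2r// hN.
rewrite ler_norml; apply/andP; split.
  apply: limr_ge => //; exists N => // n /= /sn.
  by rewrite ler_norml => /andP[].
apply: limr_le => //; exists N => // n /= /sn.
by rewrite ler_norml => /andP[].
Qed.

Lemma powR_le_eps (eta e : R) : 0 < eta -> 0 < e ->
  exists T : R, forall t, T < t -> t `^ (- eta) <= e.
Proof.
move=> eta0 e0; exists ((e^-1) `^ (eta^-1)) => t Tt.
have T0 : 0 < (e^-1) `^ (eta^-1) by rewrite powR_gt0// invr_gt0.
have t0 : 0 < t by exact: lt_trans Tt.
rewrite powRN -[leRHS]invrK lef_pV2 ?posrE ?invr_gt0 ?powR_gt0//.
have -> : e^-1 = ((e^-1) `^ (eta^-1)) `^ eta.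
  by rewrite -powRrM mulVf ?gt_eqF// powRr1// invr_ge0 ltW.
by apply: ge0_ler_powR; rewrite ?nnegrE ltW.
Qed.

Lemma ler_powR_small (a x y : R) : 0 < a -> a <= 1 -> x <= y -> a `^ y <= a `^ x.
Proof.
move=> a0 a1 xy; rewrite /powR gt_eqF// ler_expR ler_wnM2r// ln_le0//.
Qed.

(** At [e = 0] the solution is [k = (m + alpha) / alpha], which is at least 1, less than 2 by
    [m < alpha], and satisfies [k (1 + alpha) < s] by assumption. The strict inequalities leave room
    for a positive Potter loss [e]. *)
Lemma jump_exponent (alpha s : R) (m : nat) : 0 < alpha -> m%:R < alpha ->
  (m%:R + alpha) * (1 + alpha) < s * alpha ->
  exists2 e : R, 0 < e < alpha & exists2 k : R, 1 <= k <= 2 &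
    k * (alpha - e) = m%:R + alpha + 2 * e /\ k * (1 + (alpha - e)) <= s.
Proof.
move=> a0 ma hs; have m0 : 0 <= m%:R :> R by [].
have s0 : 0 < s.
  rewrite -(pmulr_lgt0 _ a0); apply: lt_trans hs.
  by rewrite mulr_gt0//; lra.
have q0 : 0 < 2 * (1 + alpha) + s by lra.
(* The three entries ensure, in this order, [k (1 + (alpha - e)) <= s], [k <= 2] and
   [alpha - e > 0]. *)
pose e := Num.min ((s * alpha - (m%:R + alpha) * (1 + alpha)) / (2 * (1 + alpha) + s))
  (Num.min ((alpha - m%:R) / 4) (alpha / 2)).
have e0 : 0 < e by rewrite !lt_min !divr_gt0 ?subr_gt0.
have e1 : e * (2 * (1 + alpha) + s) <= s * alpha - (m%:R + alpha) * (1 + alpha).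
  by rewrite -ler_pdivlMr// ge_min lexx.
have e2 : e <= (alpha - m%:R) / 4 by rewrite !ge_min lexx orbT.
have e3 : e <= alpha / 2 by rewrite !ge_min lexx !orbT.
have ae : 0 < alpha - e by lra.
exists e; first by apply/andP; split; lra.
have kE : (m%:R + alpha + 2 * e) / (alpha - e) * (alpha - e) = m%:R + alpha + 2 * e.
  by rewrite divfK ?gt_eqF.
exists ((m%:R + alpha + 2 * e) / (alpha - e)).
  by rewrite ler_pdivlMr// ler_pdivrMr//; apply/andP; split; lra.
split => //.
rewrite mulrAC ler_pdivrMr//.
nra.
Qed.

Lemma two_jump_bound (h : R -> R) (alpha s d : R) (m : nat) :
  0 < alpha -> m%:R < alpha -> (m%:R + alpha) * (1 + alpha) < s * alpha -> 0 < d ->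
  (forall x y, x <= y -> h y <= h x) -> (forall x, 0 < h x <= 1) ->
  cvg_ratio h (- alpha) ->
  exists2 C : R, 0 < C & exists2 eta : R, 0 < eta & exists T : R,
  forall (t x : R) (n : nat), T < t ->
    x <= n.+1%:R ^+ 2 * h (d * t / n.+1%:R) ^+ 2 ->
    x <= 1 + n.+1%:R * h (d * t / n.+1%:R) ->
    x <= C * n.+1%:R `^ s * t `^ (- eta) * (t ^- m * h t).
Proof.
move=> a0 ma hs d0 hn h01 hr.
have h0 x : 0 < h x by have /andP[] := h01 x.
have [e /andP[e0 ea] [k /andP[k1 k2] [kE ks]]] := jump_exponent a0 ma hs.
pose b := alpha - e.
have b0 : 0 < b by rewrite subr_gt0.
have ba : b < alpha by rewrite /b; lra.
have [C1 C10 hC1] := potter_upper b0 ba hn h01 hr.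
have ae0 : 0 < alpha + e by lra.
have aae : alpha < alpha + e by lra.
have [C2 C20 [T hT]] := potter_lower ae0 aae hn h0 hr.
pose K := (C1 * d `^ (- b)) `^ k.
have K0 : 0 < K by rewrite powR_gt0// mulr_gt0// powR_gt0.
exists (2 * K / C2); first by rewrite !mulr_gt0// invr_gt0.
exists e => //; exists (Num.max T 0) => t x n; rewrite gt_max => /andP[Tt t0] x1 x2.
set N := (n.+1%:R : R); have N0 : 0 < N by []; have N1 : 1 <= N by rewrite ler1n.
set be := h (d * t / n.+1%:R) in x1 x2.
have be0 : 0 < be by exact: h0.
have Nb0 : 0 < N * be by rewrite mulr_gt0.
(* Below 1 the exponent 2 may be lowered to [k]; above 1 the sum [1 + N * be] is at most
   [2 * (N * be)], whose exponent may be raised to [k]. *)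
have xk : x <= 2 * (N * be) `^ k.
  have [Nb1|Nb1] := leP (N * be) 1.
    apply: (@le_trans _ _ ((N * be) `^ k)); last first.
      by rewrite ler_peMl ?powR_ge0// ler1n.
    apply: (le_trans x1); rewrite -exprMn -powR_mulrn ?(ltW Nb0)//.
    exact: ler_powR_small.
  apply: (le_trans x2); apply: (@le_trans _ _ (2 * (N * be))); first by rewrite -/N; lra.
  by rewrite ler_pM2l// le1r_powR// ltW.
apply: (le_trans xk).
have dt0 : 0 < d * t / N by rewrite divr_gt0// mulr_gt0.
have Nbe : N * be <= C1 * d `^ (- b) * (N `^ (1 + b) * t `^ (- b)).
  apply: (@le_trans _ _ (N * (C1 * (d * t / N) `^ (- b)))).
    by rewrite ler_pM2l//; exact: hC1.
  rewrite powRM ?invr_ge0 ?(ltW N0) ?mulr_ge0 ?(ltW d0) ?(ltW t0)//.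
  rewrite powRM ?(ltW d0) ?(ltW t0)// powRD ?(gt_eqF N0) ?implybT// powRr1 ?(ltW N0)//.
  have -> : N^-1 `^ (- b) = N `^ b.
    by rewrite -powR_inv1 ?(ltW N0)// -powRrM mulrN mulN1r opprK.
  by rewrite le_eqVlt; apply/orP; left; apply/eqP; ring.
have Nbk : (N * be) `^ k <= K * (N `^ s * t `^ (- (m%:R + alpha + 2 * e))).
  apply: (@le_trans _ _ ((C1 * d `^ (- b) * (N `^ (1 + b) * t `^ (- b))) `^ k)).
    apply: ge0_ler_powR => //; first by lra.
      by rewrite nnegrE ltW.
    by rewrite nnegrE !mulr_ge0 ?powR_ge0// ltW.
  rewrite powRM ?mulr_ge0 ?powR_ge0 ?(ltW C10)// -/K ler_pM2l//.
  rewrite powRM ?powR_ge0// -!powRrM ler_pM ?powR_ge0//.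
    by apply: ler_powR => //; rewrite mulrC.
  by rewrite mulNr mulrC kE.
(* The exponent splits in three: [- e] remains as the decay, [- m] is the factor of the target, and
   [- (alpha + e)] is paid for by the lower Potter bound on [h t]. *)
have tD : t `^ (- (m%:R + alpha + 2 * e)) <= C2^-1 * (t `^ (- e) * (t ^- m * h t)).
  have -> : - (m%:R + alpha + 2 * e) = - e + (- m%:R + - (alpha + e)) by ring.
  rewrite !powRD ?(gt_eqF t0) ?implybT//.
  have -> : t `^ (- m%:R) = t ^- m by rewrite powRN powR_mulrn// (ltW t0).
  rewrite [leRHS]mulrCA ler_pM2l ?powR_gt0// [leRHS]mulrCA ler_pM2l ?invr_gt0 ?exprn_gt0//.
  by rewrite [leRHS]mulrC ler_pdivlMr// mulrC; exact: hT.
apply: (@le_trans _ _ (2 * (K * (N `^ s * (C2^-1 * (t `^ (- e) * (t ^- m * h t))))))).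
  rewrite ler_pM2l//; apply: (le_trans Nbk); rewrite ler_pM2l//.
  by rewrite ler_pM2l ?powR_gt0.
by rewrite le_eqVlt; apply/orP; left; apply/eqP; ring.
Qed.

(** If [h] vanished at a point it would vanish from there on; the ratio for [l = 1] would then be 0,
    division by 0 giving 0, instead of tending to 1. *)
Lemma cvg_ratio_gt0 (h : R -> R) rho : (forall x y, x <= y -> h y <= h x) ->
  (forall x, 0 <= h x) -> cvg_ratio h rho -> forall x, 0 < h x.
Proof.
move=> hn h0 hr x; rewrite lt_neqAle h0 andbT eq_sym; apply/negP => /eqP hx.
have hy y : x <= y -> h y = 0 by move=> xy; apply/eqP; rewrite eq_le h0 -hx hn.
have p0 : 0 < (1 : R) `^ rho by rewrite powR_gt0.
have /cvg_pinfty_distP/(_ _ (divr_gt0 p0 (ltr0Sn _ 1)))[T hT] := hr 1 ltr01.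
have := hT (Num.max T x + 1); rewrite (le_lt_trans (_ : T <= Num.max T x)) ?ltrDl ?le_max ?lexx//.
move=> /(_ isT); rewrite mul1r hy ?mul0r ?sub0r ?normrN ?(gtr0_norm p0).
  by rewrite ler_pdivlMr// ger_pMr// lern1.
by rewrite (le_trans (_ : x <= Num.max T x)) ?le_max ?lexx ?orbT// lerDl.
Qed.

End Summation.

(** * Averaging over the number of summands *)

Section Compound.
Variable R : realType.
Variable mu : probability R R.

Lemma convpow_tail n t : 1 - convpow mu n t = fine (sum_law mu n `]t, +oo[%classic).
Proof.
have -> : `]t, +oo[%classic = ~` `]-oo, t]%classic by rewrite setCitvl.
rewrite probability_setC// fineB//; last by rewrite fin_num_measure.
congr (_ - fine _).
have := @ge0_conv_int R mu n (\1_(`]-oo, t]%classic)) 0 (measurable_indic _) (fun x => ler0n _ _).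
move=> /(_ (measurable_itv _)).
under eq_fun do rewrite add0r; under eq_integral do rewrite add0r.
by move=> ->; rewrite integral_indic// setIT.
Qed.

Lemma tail_cvg0 : tail mu @ +oo --> (0 : R).
Proof.
pose X : {mfun R >-> R} := HB.pack (fun x : R => x)
  (isMeasurableFun.Build _ _ R R (fun x : R => x) (@measurable_id _ R setT)).
have := @cvg_ccdfy0 _ _ _ mu X.
rewrite (_ : ccdf _ = EFin \o tail mu); last first.
  by apply/funext => t; rewrite /= tailE /ccdf /distribution /pushforward preimage_id.
by move/fine_cvgP => [].
Qed.

Lemma cvg_sum_ord (k : nat) (u : nat -> nat -> R) (l : nat -> R) :
  (forall j, (j < k)%N -> u j @ \oo --> l j) ->
  (fun N => \sum_(j < k) u j N) @ \oo --> \sum_(j < k) l j.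
Proof.
elim: k => [|k IH] ul.
  by rewrite big_ord0; under eq_fun do rewrite big_ord0; exact: cvg_cst.
rewrite big_ord_recr/=; under eq_fun do rewrite big_ord_recr/=.
by apply: cvgD; [apply: IH => j jk; apply: ul; exact: ltnW|exact: ul].
Qed.

Hypothesis mu0 : mu `]-oo, 0[%classic = 0%E.
Variables (m : nat) (M : R).
Hypothesis M1 : 1 <= M.
Hypothesis hM : (\int[mu]_y (`|y| ^+ m)%:E <= M%:E)%E.
Variables (p : nat -> R) (s : R).
Hypothesis p0 : forall n, 0 <= p n.
Hypothesis p1 : series p @ \oo --> (1 : R).
Hypothesis s1 : m.+1%:R <= s.
Hypothesis pc : cvgn (series (fun n => p n * n%:R `^ s)).

Let e := sum_moment mu.

Let coef j : R := limn (series (fun n => p n * n%:R * e n.-1 j)).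

(** The position of the large jump contributes [n] and the moments of the other summands [n^m],
    hence the requirement [m + 1 <= s]. *)
Lemma weighted_power_le n : n%:R * (1 + n.-1%:R ^+ m * M) <= (1 + M) * n%:R `^ s.
Proof.
case: n => [|n]; first by rewrite mul0r mulr_ge0 ?powR_ge0// addr_ge0// (le_trans ler01).
have n1 : 1 <= n.+1%:R :> R by rewrite ler1n.
apply: (@le_trans _ _ ((1 + M) * n.+1%:R ^+ m.+1)); last first.
  rewrite ler_pM2l; last by rewrite addr_gt0// (lt_le_trans ltr01).
  by rewrite -powR_mulrn//; exact: ler_powR.
rewrite exprS mulrCA ler_pM2l// mulrDl mul1r lerD//; first exact: exprn_ege1.
rewrite mulrC ler_pM2l; last by rewrite (lt_le_trans ltr01).
by rewrite lerXn2r ?nnegrE// ler_nat leqnSn.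
Qed.

Lemma cvg_coef j : (j <= m)%N -> series (fun n => p n * n%:R * e n.-1 j) @ \oo --> coef j.
Proof.
move=> jm; have e0 n : 0 <= e n j by exact: (@sum_moment_ge0 _ mu mu0 m M M1 hM).
have vc : cvgn (series (fun n => (1 + M) * (p n * n%:R `^ s))).
  rewrite (_ : series _ = (fun n => (1 + M) * series (fun n => p n * n%:R `^ s) n)).
    exact: is_cvgMr.
  by apply/funext => n; rewrite /series/= mulr_sumr.
suff : cvgn (series (fun n => p n * n%:R * e n.-1 j)) by [].
apply: series_le_cvg vc => n.
- by rewrite !mulr_ge0.
- by rewrite !mulr_ge0 ?powR_ge0// addr_ge0// (le_trans ler01).
- rewrite -mulrA [leRHS]mulrCA ler_wpM2l//; apply: le_trans (weighted_power_le n).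
  rewrite ler_wpM2l//; have := sum_moment_bound M1 hM n.-1 jm.
  by rewrite ger0_norm// -/(e _ _).
Qed.

Lemma cmp_coefE j : (j <= m)%N -> cmp_coef mu p j = (coef j)%:E.
Proof.
move=> jm; rewrite /cmp_coef; apply/cvg_lim => //.
rewrite (_ : (fun n => _) = EFin \o series (fun n => p n * n%:R * e n.-1 j)); last first.
  (* [cmp_coef] starts at index 1 and [coef] at 0; the extra term carries the factor [n = 0]. *)
  apply/funext => -[|N] /=; first by rewrite /series/= !big_geq.
  rewrite /series/= [in RHS]big_ltn// mulr0 mul0r add0r -sumEFin.
  by apply: eq_bigr => n _; rewrite (momentE M1 hM)// EFinM.
apply: cvg_EFin; first exact: nearW.
exact: cvg_coef.
Qed.

Let b t n : R := (1 - convpow mu n t) -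
  \sum_(j < m.+1) (-1) ^+ j / j`!%:R * derive1n j (tail mu) t * (n%:R * e n.-1 j).

(** The weights [p] sum to 1, so the 1 in [1 - K] may be moved inside the average, and the whole
    remainder becomes an average of remainders for fixed [n]. *)
Lemma compound_remainderE t :
  (1 - compound_df mu p t)
       - \sum_(0 <= j < m.+1) ((-1) ^+ j / j`!%:R * coef j * derive1n j (tail mu) t)
  = limn (series (fun n => p n * b t n)).
Proof.
have cp01 n : 0 <= convpow mu n t <= 1.
  have := convpow_tail n t.
  have h1 : fine (sum_law mu n `]t, +oo[%classic) <= 1.
    by rewrite -lee_fin fineK ?fin_num_measure//; apply: probability_le1.
  have h2 : 0 <= fine (sum_law mu n `]t, +oo[%classic) by exact: fine_ge0.
  by move=> h; apply/andP; split; lra.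
have cK : series (fun n => p n * convpow mu n t) @ \oo --> compound_df mu p t.
  suff : cvgn (series (fun n => p n * convpow mu n t)) by [].
  apply: (@series_le_cvg _ _ p) => // [n|n|]; last by apply/cvg_ex; exists 1.
    by have /andP[? _] := cp01 n; rewrite mulr_ge0.
  by have /andP[_ ?] := cp01 n; rewrite ler_piMr.
apply/esym/cvg_lim => //.
rewrite (_ : series _ = fun N => series p N - series (fun n => p n * convpow mu n t) N -
  \sum_(j < m.+1) (-1) ^+ j / j`!%:R * derive1n j (tail mu) t *
     series (fun n => p n * n%:R * e n.-1 j) N); last first.
  apply/funext => N; rewrite /series/=.
  under [X in _ = _ - X]eq_bigr do rewrite mulr_sumr.
  rewrite [X in _ = _ - X]exchange_big/= -!sumrB; apply: eq_bigr => n _.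
  rewrite /b mulrBr mulrBr mulr1 mulr_sumr; congr (_ - _); apply: eq_bigr => j _.
  by move: (_ / _ * _) => x; ring.
apply: cvgB; first exact: cvgB.
rewrite big_mkord.
rewrite (_ : \sum_(j < m.+1) _ = \sum_(j < m.+1) (-1) ^+ j / j`!%:R * derive1n j (tail mu) t * coef j).
  apply: (@cvg_sum_ord m.+1 (fun j N => (-1) ^+ j / j`!%:R * derive1n j (tail mu) t *
     series (fun n => p n * n%:R * e n.-1 j) N) (fun j => (-1) ^+ j / j`!%:R * derive1n j (tail mu) t * coef j)).
  by move=> j jm; apply: cvgMl_tmp; exact: cvg_coef.
by apply: eq_bigr => j _; rewrite mulrAC.
Qed.

End Compound.

(** * The expansion of the compound tail *)

Theorem theorem4p4p1 (R : realType) (alpha omega : R) (mu : probability R R)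
  (m : nat) (gamma : R) (p : nat -> R) (s : R) :
  0 < alpha -> 1 <= omega ->
  mu `]-oo, 0[%classic = 0%E ->
  continuous (distr_fun mu) ->
  SR alpha omega (fun t => 1 - distr_fun mu t) ->
  m%:R < alpha -> m%:R < omega ->
  0 < gamma -> gamma < Num.min 1 (omega - m%:R) ->
  (forall n, 0 <= p n) -> series p @ \oo --> (1 : R) ->
  (alpha + m%:R) / gamma * Num.max ((alpha + omega) / alpha) 2 + m%:R < s ->
  cvg (series (fun n => p n * n%:R `^ s) @ \oo) ->
  exists c : nat -> R,
    (forall j, (j <= m)%N -> cmp_coef mu p j = (c j)%:E) /\
    littleo_pinfty
    (fun t => (1 - compound_df mu p t)
       - \sum_(0 <= j < m.+1) ((-1) ^+ j / j`!%:R * c j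
                                * derive1n j (fun u => 1 - distr_fun mu u) t))
    (fun t => t ^- m * (1 - distr_fun mu t)).
Proof.
move=> a0 om1 mu0 Fc SRh ma mom g0 gmin p0 p1 hs pc.
have m0 : 0 <= m%:R :> R by [].
have g1 : gamma < 1 by move: gmin; rewrite lt_min => /andP[].
(* [gamma < 1] and [omega >= 1] bring the assumption on [s] to the form used by [two_jump_bound]. *)
have hs' : (m%:R + alpha) * (1 + alpha) < s * alpha.
  have h1 : (alpha + m%:R) * ((1 + alpha) / alpha) <=
            (alpha + m%:R) / gamma * Num.max ((alpha + omega) / alpha) 2.
    apply: ler_pM; [lra|by rewrite divr_ge0//; lra| |].
      by rewrite ler_pdivlMr// ger_pMr; lra.
    by rewrite le_max ler_pM2r ?invr_gt0//; apply/orP; left; lra.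
  have h2 : (alpha + m%:R) * ((1 + alpha) / alpha) < s by lra.
  by move: h2; rewrite mulrA ltr_pdivrMr// addrC.
have s1 : m.+1%:R <= s.
  rewrite -(ler_pM2r a0) -natr1; apply/ltW; apply: le_lt_trans hs'.
  by nra.
have hn := @tail_nonincr R mu.
have hl := tail_cvg0 mu.
have [hd hsl hr] := SR_structure SRh hl mom.
have h0 := cvg_ratio_gt0 hn (@tail_ge0 R mu) hr.
have h01 x : 0 < tail mu x <= 1 by rewrite h0 tail_le1.
have mt : measurable_fun setT (tail mu).
  by apply: measurable_funB => //; exact: continuous_measurable_fun.
(* Potter's bound with an exponent halfway between [m] and [alpha] gives the moment of order [m];
   adding 1 ensures [1 <= M]. *)
have [M M1 hM] : exists2 M : R, 1 <= M & (\int[mu]_y (`|y| ^+ m)%:E <= M%:E)%E.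
  have b0 : 0 < (m%:R + alpha) / 2 by lra.
  have ba : (m%:R + alpha) / 2 < alpha by lra.
  have mb : m%:R < (m%:R + alpha) / 2 by lra.
  have [C C0 hC] := potter_upper b0 ba hn h01 hr.
  have fin := moment_lty mu0 C0 mb hC.
  have X0 : (0 <= \int[mu]_y (`|y| ^+ m)%:E)%E.
    by apply: integral_ge0 => y _; exact: absX_ge0.
  exists (1 + fine (\int[mu]_y (`|y| ^+ m)%:E)); first by rewrite lerDl fine_ge0.
  by rewrite EFinD fineK ?ge0_fin_numE// leeDr.
have [d /andP[d0 d1] [[C C0 [T1 hT1]] hlim]] := jump_rem_bound h0 hd hsl.
have [C2 C20 [eta eta0 [T2 hT2]]] := two_jump_bound a0 ma hs' d0 hn h01 hr.
pose D (t : R) : R := t ^- m * tail mu t.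
have D0 (t : R) : 0 < t -> 0 < D t by move=> t0; rewrite mulr_gt0// invr_gt0 exprn_gt0.
pose e := sum_moment mu.
pose b t n : R := (1 - convpow mu n t) -
  \sum_(j < m.+1) (-1) ^+ j / j`!%:R * derive1n j (tail mu) t * (n%:R * e n.-1 j).
(* For [n.+1] summands, [I1] is the error of the one-big-jump approximation and [I2] the Taylor
   error averaged over the other [n] summands. *)
pose I1 t n : R := fine (sum_law mu n.+1 `]t, +oo[%classic)
    - n.+1%:R * fine (\int[sum_law mu n]_y (jump_kernel mu d t y)%:E).
pose I2 t n : R := fine (\int[sum_law mu n]_y (jump_rem (tail mu) m d t y)%:E).
have bS t n : b t n.+1 = I1 t n + n.+1%:R * I2 t n.
  rewrite /b convpow_tail /I1 /I2 -(integral_jump_rem M1 hM mt) mulrBr addrA subrK.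
  congr (_ - _); rewrite mulr_sumr; apply: eq_bigr => j _.
  by rewrite mulrCA.
(* The empty sum is 0 and never exceeds [t > 0]; in the expansion the factor [n = 0] removes the
   moment at the default index [0.-1]. *)
have b_0 (t : R) : 0 < t -> b t 0%N = 0.
  move=> t0; rewrite /b convpow_tail.
  have -> : fine (sum_law mu 0 `]t, +oo[%classic) = 0.
    by rewrite /= indicE mem_setE in_itv/= andbT ltNge (ltW t0).
  by rewrite sub0r big1 ?oppr0// => j _; rewrite mul0r mulr0.
have I1b t n : Num.max T2 0 < t -> `|I1 t n| <= C2 * n.+1%:R `^ s * t `^ (- eta) * D t.
  rewrite gt_max => /andP[T2t t0]; apply: hT2 => //.
    by apply: one_big_jump => //; rewrite d0 d1.
  apply: one_big_jump_crude => //.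
  apply: (@le_trans _ _ (d * t)); last by rewrite ler_pM2r//; lra.
  by rewrite ler_pdivrMr// ler_peMr ?ler1n// mulr_ge0// ltW.
have I2b t n : Num.max T1 0 < t -> `|I2 t n| <= C * D t * (n%:R ^+ m * M).
  rewrite gt_max => /andP[T1t t0]; apply: (integral_jump_rem_bound mu0 M1 hM mt).
    by rewrite mulr_ge0 ?ltW// D0.
  by move=> y y0; apply: (le_trans (hT1 _ _ T1t y0)); rewrite mulrAC.
have [T3 hT3] := powR_le_eps eta0 ltr01.
pose T := Num.max (Num.max T1 0) (Num.max (Num.max T2 0) T3).
(* [C2] comes from [I1], once [t] to the power [- eta] is at most 1, and [C * (1 + M)] from [I2]
   through [weighted_power_le]. *)
pose v n : R := (C2 + C * (1 + M)) * (p n * n%:R `^ s).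
have M0 : 0 <= M by exact: le_trans M1.
have K0 : 0 <= C2 + C * (1 + M) by rewrite addr_ge0 ?mulr_ge0 ?addr_ge0// ltW.
have pw : cvgn (series v).
  rewrite (_ : series v = (fun n => (C2 + C * (1 + M)) * series (fun n => p n * n%:R `^ s) n)).
    exact: is_cvgMr.
  by apply/funext => n; rewrite /series/= mulr_sumr.
have bound t n : T < t -> `|p n * b t n| <= v n * D t.
  rewrite /T gt_max => /andP[T1t]; rewrite gt_max => /andP[T2t T3t].
  have t0 : 0 < t by move: T1t; rewrite gt_max => /andP[].
  have Dt := D0 _ t0.
  have -> : v n * D t = p n * ((C2 + C * (1 + M)) * n%:R `^ s * D t) by rewrite /v; ring.
  rewrite normrM (ger0_norm (p0 n)) ler_wpM2l//.
  case: n => [|n]; first by rewrite b_0// normr0 mulr_ge0 ?(ltW Dt)// mulr_ge0// powR_ge0.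
  rewrite bS; apply: (le_trans (ler_normD _ _)); rewrite mulrDl mulrDl lerD//.
    apply: (le_trans (I1b _ _ T2t)); rewrite ler_pM2r//.
    by rewrite ler_piMr ?mulr_ge0 ?powR_ge0 ?(ltW C20)// hT3.
  rewrite normrM ger0_norm//.
  apply: (@le_trans _ _ (n.+1%:R * (C * D t * (n%:R ^+ m * M)))).
    by rewrite ler_pM2l// I2b.
  have := weighted_power_le M1 s1 n.+1 => /= hw.
  have hw' : n.+1%:R * (n%:R ^+ m * M) <= (1 + M) * n.+1%:R `^ s.
    by apply: le_trans hw; rewrite ler_pM2l// lerDr.
  have -> : n.+1%:R * (C * D t * (n%:R ^+ m * M)) = C * D t * (n.+1%:R * (n%:R ^+ m * M)) by ring.
  have -> : C * (1 + M) * n.+1%:R `^ s * D t = C * D t * ((1 + M) * n.+1%:R `^ s) by ring.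
  by rewrite ler_pM2l// mulr_gt0.
have small n (eps : R) : 0 < eps -> exists T' : R, forall t, T' < t -> `|p n * b t n| <= eps * D t.
  move=> eps0; case: n => [|n].
    by exists 0 => t t0; rewrite b_0// mulr0 normr0 mulr_ge0 ?(ltW eps0)// (ltW (D0 _ t0)).
  (* Dominates the weight [p n.+1] and stays positive when that weight is 0. *)
  pose q := p n.+1 + 1; have q0 : 0 < q by rewrite ltr_wpDl.
  pose e1 := eps / 2 / q; have e10 : 0 < e1 by rewrite !divr_gt0.
  have Cn0 : 0 < C2 * n.+1%:R `^ s by rewrite mulr_gt0// powR_gt0.
  have [T4 hT4] := powR_le_eps eta0 (divr_gt0 e10 Cn0).
  have D0' t : Num.max T1 0 < t -> 0 < D t by rewrite gt_max => /andP[_]; exact: D0.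
  have hT1' t y : Num.max T1 0 < t -> 0 <= y -> `|jump_rem (tail mu) m d t y| <= C * y ^+ m * D t.
    by rewrite gt_max => /andP[T1t _]; exact: hT1.
  have [T5 hT5] := integral_jump_rem_littleo mu0 M1 hM mt n C0 D0' hT1' hlim
     (divr_gt0 e10 (ltr0Sn _ n)).
  exists (Num.max (Num.max T2 0) (Num.max T4 T5)) => t; rewrite gt_max => /andP[T2t].
  rewrite gt_max => /andP[T4t T5t].
  have t0 : 0 < t by move: T2t; rewrite gt_max => /andP[].
  have Dt := D0 _ t0.
  have h1 : `|I1 t n| <= e1 * D t.
    apply: (le_trans (I1b _ _ T2t)); rewrite ler_pM2r//.
    by rewrite mulrC -ler_pdivlMr// hT4.
  have h2 : `|n.+1%:R * I2 t n| <= e1 * D t.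
    rewrite normrM ger0_norm// mulrC -ler_pdivlMr// mulrAC; exact: hT5.
  have h3 : `|b t n.+1| <= eps / q * D t.
    rewrite bS (_ : eps / q * D t = e1 * D t + e1 * D t).
      by apply: (le_trans (ler_normD _ _)); exact: lerD.
    by rewrite /e1; field; rewrite gt_eqF.
  rewrite normrM (ger0_norm (p0 _)).
  apply: (@le_trans _ _ (q * (eps / q * D t))).
    by apply: ler_pM => //; rewrite lerDl.
  by rewrite mulrA (mulrC q) divfK ?gt_eqF.
have Dge t : T < t -> 0 <= D t.
  rewrite /T gt_max => /andP[]; rewrite gt_max => /andP[_ t0] _.
  by apply/ltW/D0.
have v0 n : 0 <= v n by rewrite !mulr_ge0 ?powR_ge0.
have tan := tannery Dge v0 bound pw small.
exists (fun j => limn (series (fun n => p n * n%:R * e n.-1 j))); split.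
  by move=> j jm; apply: cmp_coefE mu0 m M M1 hM p s p0 s1 pc j jm.
move=> eps eps0; apply/near_pinftyP; have [T' hT'] := tan _ eps0.
exists (Num.max T' 0) => t; rewrite gt_max => /andP[T't t0].
have := compound_remainderE mu0 M1 hM p0 p1 s1 pc t.
rewrite -[(fun u : R => 1 - distr_fun mu u)]/(tail mu) => ->.
rewrite -[1 - distr_fun mu t]/(tail mu t) -/(D t) (gtr0_norm (D0 _ t0)).
exact: hT'.
Qed.
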